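(* Let $\mathscr{B}$ be a Fell bundle over a locally compact group $G$ and let $H$ be a closed subgroup of $G$. Then any non-degenerate $\ast$-representation of $\mathscr{B}_H$ is $\mathscr{B}$-positive.
   Context: $G$ has left Haar measure $dx$ and modular function $\Delta$; $H$ has left Haar measure $dh$ and modular function $\delta$ (convention $\int_G f(xy)\,dx=\Delta(y)^{-1}\int_G f(x)\,dx$). A Fell bundle $\mathscr{B}=\{B_x\}_{x\in G}$ over $G$ is a continuous Banach bundle with bundle space $B$, with continuous associative multiplications $B_x\times B_y\to B_{xy}$ (bilinear, $\|ab\|\le\|a\|\|b\|$) and continuous conjugate-linear involutions $B_x\to B_{x^{-1}}$ with $(ab)^*=b^*a^*$, $a^{**}=a$, $\|a^*a\|=\|a\|^2$ and $a^*a\ge0$ in the C*-algebra $B_e$. $\mathscr{B}_H$ is the restriction of $\mathscr{B}$ to $H$. $\mathscr{L}(\mathscr{B})$ is the space of compactly supported continuous cross-sections of $\mathscr{B}$, a $\ast$-algebra under $(f*g)(x)=\int_G f(y)g(y^{-1}x)\,dy$, $f^*(x)=\Delta(x)^{-1}f(x^{-1})^*$. A $\ast$-representation $S$ of $\mathscr{B}_H$ on a Hilbert space $X$ is a strongly continuous, fibrewise linear map from the bundle space of $\mathscr{B}_H$ into the bounded operators on $X$ with $S_{ab}=S_aS_b$, $S_{a^*}=S_a^*$; for $\phi\in\mathscr{L}(\mathscr{B}_H)$ put $S_\phi=\int_H S_{\phi(h)}\,dh$. Define $p:\mathscr{L}(\mathscr{B})\to\mathscr{L}(\mathscr{B}_H)$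 by $p(f)(h)=f(h)\Delta(h)^{1/2}\delta(h)^{-1/2}$. $S$ is $\mathscr{B}$-positive if $S_{p(f^**f)}\ge0$ for all $f\in\mathscr{L}(\mathscr{B})$. *)

(* Defs.v *)
From HB Require Import structures.
From mathcomp Require Import all_boot all_order all_algebra.
From mathcomp Require Import complex.
From mathcomp Require Import all_classical all_reals all_analysis.

Set Implicit Arguments.
Unset Strict Implicit.
Unset Printing Implicit Defensive.

Import Order.TTheory GRing.Theory Num.Theory.
Import numFieldNormedType.Exports.

Local Open Scope classical_set_scope.
Local Open Scope ring_scope.
Local Open Scope complex_scope.

HB.mixin Record Group_isTopological G & Group G & Topological G := {
  mulg_continuous : continuous (fun xy : G * G => (xy.1 * xy.2)%g);
  invg_continuous : continuous (fun x : G => x^-1%g)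
}.

(* The base point is only there because the measurable spaces of the library
   are pointed. *)
#[short(type="topGroupType")]
HB.structure Definition TopGroup :=
  {G of Group G & PointedTopological G & Group_isTopological G}.

Record closedSubgroup (G : topGroupType) := ClosedSubgroup {
  csg_set : set G;
  csg_closed : closed csg_set;
  csg_group : group_closed (fun x => x \in csg_set)
}.

Definition subgroup_type (G : topGroupType) (H : closedSubgroup G) : Type :=
  set_type (csg_set H).
Coercion subgroup_type : closedSubgroup >-> Sortclass.

Section SubgroupType.
Context (G : topGroupType) (H : closedSubgroup G).
Implicit Types h k : H.

Definition sgval h : G := val (h : set_type (csg_set H)).

HB.instance Definition _ := Topological.copy (H : Type) (set_type (csg_set H)).

Lemma sgval_inj : injective sgval.
Proof. exact: val_inj. Qed.

Lemma sgvalP h : sgval h \in csg_set H.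
Proof. exact: (valP (h : set_type (csg_set H))). Qed.

Let sg_one : H := exist _ 1%g (csg_group H).1.
Let sg_inv h : H := exist _ (sgval h)^-1%g
  (group_closedV (csg_group H) (sgvalP h)).
Let sg_mul h k : H := exist _ (sgval h * sgval k)%g
  (group_closedM (csg_group H) (sgvalP h) (sgvalP k)).

Let sg_mulA : associative sg_mul.
Proof. by move=> x y z; apply: sgval_inj; rewrite /sgval/= mulgA. Qed.
Let sg_mul1 : left_id sg_one sg_mul.
Proof. by move=> x; apply: sgval_inj; rewrite /sgval/= mul1g. Qed.
Let sg_1mul : right_id sg_one sg_mul.
Proof. by move=> x; apply: sgval_inj; rewrite /sgval/= mulg1. Qed.
Let sg_mulV : left_inverse sg_one sg_inv sg_mul.
Proof. by move=> x; apply: sgval_inj; rewrite /sgval/= mulVg. Qed.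
Let sg_Vmul : right_inverse sg_one sg_inv sg_mul.
Proof. by move=> x; apply: sgval_inj; rewrite /sgval/= mulgV. Qed.

HB.instance Definition _ := isPointed.Build (H : Type) sg_one.
HB.instance Definition _ := isGroup.Build (H : Type)
  sg_mulA sg_mul1 sg_1mul sg_mulV sg_Vmul.

Lemma sgval_continuous : continuous sgval.
Proof. exact: initial_continuous. Qed.

Lemma cvg_sgval (F : set_system H) h :
  Filter F -> sgval @ F --> sgval h -> F --> h.
Proof.
move=> FF cF A [_ [[B Bop <-] Bh BA]]; apply: filterS BA _.
by apply: cF; exact: open_nbhs_nbhs.
Qed.

Let sg_mul_cont : continuous (fun xy : H * H => (xy.1 * xy.2)%g).
Proof.
move=> xy; apply: cvg_sgval.
apply: (@continuous_comp _ _ _ (fun p : H * H => (sgval p.1, sgval p.2))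
  (fun p : G * G => (p.1 * p.2)%g)); last exact: mulg_continuous.
apply: cvg_pair; apply: continuous_comp.
- exact: cvg_fst.
- exact: sgval_continuous.
- exact: cvg_snd.
- exact: sgval_continuous.
Qed.

Let sg_inv_cont : continuous (fun x : H => x^-1%g).
Proof.
move=> x.
have cV : {for x, continuous ((fun p : G => p^-1%g) \o sgval)}.
  apply: continuous_comp; first exact: sgval_continuous.
  exact: invg_continuous.
have FH : Filter (nbhs x) by exact: (@nbhs_filter (H : topologicalType) x).
by apply: cvg_sgval; exact: cV.
Qed.

HB.instance Definition _ :=
  Group_isTopological.Build (H : Type) sg_mul_cont sg_inv_cont.

End SubgroupType.

Definition borel (G : ptopologicalType) := g_sigma_algebraType (@open G).

Definition compactly_supported (T : topologicalType) (P : set T) :=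
  exists2 K : set T, compact K & P `<=` K.

Section HaarMeasure.
Context (R : realType) (G : topGroupType).

(* Nonzero left-invariant Radon measure. *)
Record left_haar (mu : {measure set (borel G) -> \bar R}) : Prop := LeftHaar {
  haar_neq0 : mu [set: G] != 0%E;
  haar_compact : forall K : set G, compact K -> (mu K < +oo)%E;
  haar_outer_regular : forall A : set (borel G), measurable A ->
    mu A = ereal_inf [set mu U | U in [set U : set G | open U /\ A `<=` U]];
  haar_inner_regular : forall U : set G, open U ->
    mu U = ereal_sup [set mu K | K in [set K : set G | compact K /\ K `<=` U]];
  haar_left_invariant : forall (x : G) (A : set (borel G)), measurable A ->
    mu [set (x * y)%g | y in (A : set G)] = mu A
}.

Definition is_modular (mu : {measure set (borel G) -> \bar R})
    (Delta : G -> R) :=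
  (forall y, 0 < Delta y) /\
  forall (f : G -> R) (y : G),
    continuous f -> compactly_supported [set x | f x != 0] ->
    \int[mu]_x f (x * y)%g = (Delta y)^-1 * \int[mu]_x f x.

End HaarMeasure.

Section BochnerIntegral.
Context d (T : measurableType d) (R : realType) (V : completeNormedModType R[i]).
Implicit Types (mu : {measure set T -> \bar R}) (s : seq (set T * V)).

Definition rnorm (W : normedModType R[i]) (w : W) : R := complex.Re `|w|.

Definition simple_fun s (x : T) : V := \sum_(p <- s) (\1_(p.1) x : R[i]) *: p.2.

Definition simple_integral mu s : V :=
  \sum_(p <- s) (fine (mu p.1))%:C *: p.2.

Definition simple_integrable mu s :=
  forall p, p \in s -> measurable p.1 /\ (mu p.1 < +oo)%E.

(* The norms must be measurable for the integrals below to be meaningful, as F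
   itself is not assumed to be measurable. *)
Definition is_bochner_integral mu (F : T -> V) (v : V) :=
  exists s : nat -> seq (set T * V),
    [/\ forall n, simple_integrable mu (s n),
        forall n, measurable_fun [set: T]
          (fun x => rnorm (F x - simple_fun (s n) x)),
        (fun n => \int[mu]_x (rnorm (F x - simple_fun (s n) x))%:E)%E @ \oo
          --> 0%E &
        (fun n => simple_integral mu (s n)) @ \oo --> v].

(* The junk value 0 is only taken when F is not Bochner integrable. *)
Definition bochner_integral mu (F : T -> V) : V :=
  xget 0 [set v | is_bochner_integral mu F v].

End BochnerIntegral.

Lemma continuous_initial (S : choiceType) (T U : topologicalType) (g : S -> U)
    (f : T -> initial_topology g) :
  continuous (g \o f : T -> U) -> continuous f.
Proof.
by move=> cgf; apply/continuousP => _ [A oA <-]; move/continuousP : cgf; exact.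
Qed.

Section BanachBundle.
Context (R : realType) (G : topologicalType).

(* The topology of the bundle space is part of the data of the bundle: it is
   neither the sum topology that the library puts on {x : G & fiber x} nor
   determined by the topologies of the fibres. *)
Record topBundle := TopBundle {
  fiber : G -> completeNormedModType R[i];
  bopen : set (set {x : G & fiber x});
  bopenT : bopen setT;
  bopenI : setI_closed bopen;
  bopen_bigcup : forall (I : Type) (U : I -> set {x : G & fiber x}),
    (forall i, bopen (U i)) -> bopen (\bigcup_i U i)
}.

Definition bundle_space (B : topBundle) : Type := {x : G & fiber B x}.

HB.instance Definition _ (B : topBundle) := Choice.on (bundle_space B).
HB.instance Definition _ (B : topBundle) := isOpenTopological.Build
  (bundle_space B) (@bopenT B) (@bopenI B) (@bopen_bigcup B).

Definition bpt (B : topBundle) (x : G) (b : fiber B x) : bundle_space B :=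
  existT (fiber B) x b.

Definition bproj (B : topBundle) (b : bundle_space B) : G := projT1 b.

Definition bvec (B : topBundle) (b : bundle_space B) : fiber B (bproj b) :=
  projT2 b.

Definition bnorm (B : topBundle) (b : bundle_space B) : R := rnorm (bvec b).

(* The fibre product of the bundle space with itself; its topology is the one
   induced by bpairs_incl. *)
Definition bpairs (B : topBundle) : Type :=
  {x : G & (fiber B x * fiber B x)%type}.
HB.instance Definition _ (B : topBundle) := Choice.on (bpairs B).
Definition bpairs_incl (B : topBundle) (p : bpairs B) :
    bundle_space B * bundle_space B :=
  (bpt (projT2 p).1, bpt (projT2 p).2).

Definition badd (B : topBundle) (p : bpairs B) : bundle_space B :=
  bpt ((projT2 p).1 + (projT2 p).2).

Record is_banach_bundle (B : topBundle) : Prop := IsBanachBundle {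
  bundle_hausdorff : hausdorff_space (bundle_space B);
  bproj_continuous : continuous (@bproj B);
  bproj_open : forall U : set (bundle_space B), open U -> open (@bproj B @` U);
  bnorm_continuous : continuous (@bnorm B);
  badd_continuous :
    continuous (@badd B : initial_topology (@bpairs_incl B) -> bundle_space B);
  bscale_continuous : forall z : R[i],
    continuous (fun b : bundle_space B => bpt (z *: bvec b));
  bnorm_cvg0 : forall (F : set_system (bundle_space B)) (x : G), Filter F ->
    @bnorm B @ F --> (0 : R) -> @bproj B @ F --> x -> F --> bpt (0 : fiber B x)
}.

Definition section_map (B : topBundle) (f : forall x, fiber B x) (x : G) :
  bundle_space B := bpt (f x).

Definition cc_section (B : topBundle) (f : forall x, fiber B x) :=
  continuous (section_map f) /\ compactly_supported [set x | f x != 0].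

End BanachBundle.

Section FellBundle.
Context (R : realType) (G : topGroupType).

(* The identities relating elements of the propositionally equal fibres over,
   e.g., (x * y) * z and x * (y * z) are equalities in the bundle space. *)
Record fellBundle := FellBundle {
  fb_bundle :> topBundle R G;
  fb_banach : is_banach_bundle fb_bundle;
  fb_mul : forall x y : G,
    fiber fb_bundle x -> fiber fb_bundle y -> fiber fb_bundle (x * y)%g;
  fb_star : forall x : G, fiber fb_bundle x -> fiber fb_bundle x^-1%g;
  fb_mulDl : forall (x y : G) (a a' : fiber fb_bundle x) (b : fiber fb_bundle y),
    fb_mul (a + a') b = fb_mul a b + fb_mul a' b;
  fb_mulDr : forall (x y : G) (a : fiber fb_bundle x) (b b' : fiber fb_bundle y),
    fb_mul a (b + b') = fb_mul a b + fb_mul a b';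
  fb_mulZl : forall (x y : G) (z : R[i]) (a : fiber fb_bundle x)
    (b : fiber fb_bundle y), fb_mul (z *: a) b = z *: fb_mul a b;
  fb_mulZr : forall (x y : G) (z : R[i]) (a : fiber fb_bundle x)
    (b : fiber fb_bundle y), fb_mul a (z *: b) = z *: fb_mul a b;
  fb_mulA : forall (x y z : G) (a : fiber fb_bundle x) (b : fiber fb_bundle y)
    (c : fiber fb_bundle z),
    bpt (fb_mul (fb_mul a b) c) = bpt (fb_mul a (fb_mul b c));
  fb_mul_norm : forall (x y : G) (a : fiber fb_bundle x) (b : fiber fb_bundle y),
    `|fb_mul a b| <= `|a| * `|b|;
  fb_mul_continuous : continuous
    (fun p : bundle_space fb_bundle * bundle_space fb_bundle =>
       bpt (fb_mul (bvec p.1) (bvec p.2)));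
  fb_starD : forall (x : G) (a b : fiber fb_bundle x),
    fb_star (a + b) = fb_star a + fb_star b;
  fb_starZ : forall (x : G) (z : R[i]) (a : fiber fb_bundle x),
    fb_star (z *: a) = Num.conj z *: fb_star a;
  fb_starM : forall (x y : G) (a : fiber fb_bundle x) (b : fiber fb_bundle y),
    bpt (fb_star (fb_mul a b)) = bpt (fb_mul (fb_star b) (fb_star a));
  fb_starK : forall (x : G) (a : fiber fb_bundle x),
    bpt (fb_star (fb_star a)) = bpt a;
  fb_star_continuous : continuous
    (fun b : bundle_space fb_bundle => bpt (fb_star (bvec b)));
  fb_cstar : forall (x : G) (a : fiber fb_bundle x),
    `|fb_mul (fb_star a) a| = `|a| ^+ 2;
  (* a^* a >= 0 in the C*-algebra B_e, positive elements being the c^* c *)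
  fb_positive : forall (x : G) (a : fiber fb_bundle x),
    exists c : fiber fb_bundle 1%g,
      bpt (fb_mul (fb_star a) a) = bpt (fb_mul (fb_star c) c)
}.

Definition fiber_cast (B : fellBundle) (x y : G) (e : x = y) (b : fiber B x) :
  fiber B y := eq_rect x (fun z => fiber B z : Type) b y e.

Definition section_star (Delta : G -> R) (B : fellBundle)
    (f : forall x, fiber B x) (x : G) : fiber B x :=
  (Delta x)^-1%:C *: fiber_cast (invgK x) (fb_star (f x^-1%g)).

Definition section_conv (mu : {measure set (borel G) -> \bar R})
    (B : fellBundle) (f g : forall x, fiber B x) (x : G) : fiber B x :=
  bochner_integral mu
    (fun y : borel G =>
       fiber_cast (mulVKg (y : G) x) (fb_mul (f y) (g ((y : G)^-1 * x)%g))).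

End FellBundle.

Section Restriction.
Context (R : realType) (G : topGroupType) (H : closedSubgroup G).

Section TopBundle.
Variable B : topBundle R G.

Definition restr_incl (b : {h : H & fiber B (sgval h)}) : bundle_space B :=
  bpt (projT2 b).

Let restr_opens := @open (initial_topology restr_incl).

Let restr_opens_bigcup (I : Type)
    (U : I -> set {h : H & fiber B (sgval h)}) :
  (forall i, restr_opens (U i)) -> restr_opens (\bigcup_i U i).
Proof. by move=> oU; apply: bigcup_open => i _; exact: oU. Qed.

Definition restr_topBundle : topBundle R H :=
  @TopBundle R H (fun h => fiber B (sgval h)) restr_opens
    openT (@openI (initial_topology restr_incl)) restr_opens_bigcup.

Lemma restr_incl_inj : injective restr_incl.
Proof.
move=> [h a] [k b] /= e.
have hk : h = k by apply: sgval_inj; exact: (congr1 (@projT1 _ _) e).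
move: b e; rewrite -{}hk => b e; congr existT.
exact: existT_inj2 e.
Qed.

Lemma restr_incl_continuous :
  continuous (restr_incl : bundle_space restr_topBundle -> bundle_space B).
Proof. by apply/continuousP => A oA; exists A. Qed.

Lemma cvg_restr_incl (F : set_system (bundle_space restr_topBundle))
    (b : bundle_space restr_topBundle) :
  Filter F -> (restr_incl @ F --> restr_incl b) -> F --> b.
Proof.
move=> FF cF A [_ [[U oU <-] Ub UA]]; apply: filterS UA _.
by apply: cF; exact: open_nbhs_nbhs.
Qed.

Lemma continuous_restr (T : topologicalType)
    (f : T -> bundle_space restr_topBundle) :
  continuous (restr_incl \o f) -> continuous f.
Proof. exact: continuous_initial. Qed.

Lemma restr_incl2_continuous : continuous
  (fun p : bundle_space restr_topBundle * bundle_space restr_topBundle =>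
     (restr_incl p.1, restr_incl p.2) : bundle_space B * bundle_space B).
Proof.
move=> p.
have c1 : {for p, continuous ((restr_incl : bundle_space restr_topBundle ->
    bundle_space B) \o fst)}.
  by apply: continuous_comp; [exact: cvg_fst|exact: restr_incl_continuous].
have c2 : {for p, continuous ((restr_incl : bundle_space restr_topBundle ->
    bundle_space B) \o snd)}.
  by apply: continuous_comp; [exact: cvg_snd|exact: restr_incl_continuous].
have FF : Filter (nbhs p) by exact: nbhs_filter.
exact: (cvg_pair c1 c2).
Qed.

Lemma restr_is_banach_bundle :
  is_banach_bundle B -> is_banach_bundle restr_topBundle.
Proof.
case=> hB cproj oproj cnorm cadd cscale cvg0; split.
- move=> b c bc; apply: restr_incl_inj; apply: hB => U V Ub Vc.
  have [w [Uw Vw]] := bc _ _ (restr_incl_continuous Ub)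
    (restr_incl_continuous Vc).
  by exists (restr_incl w).
- move=> b.
  have c : {for b, continuous (@bproj _ _ B \o
      (restr_incl : bundle_space restr_topBundle -> bundle_space B))}.
    by apply: continuous_comp; [exact: restr_incl_continuous|exact: cproj].
  have FF : Filter (nbhs b) by exact: nbhs_filter.
  by apply: cvg_sgval; exact: c.
- move=> _ [U oU <-]; exists (@bproj _ _ B @` U); first exact: oproj.
  apply/seteqP; split => [h [[x a] Ua /= xh]|h [b Ub <-]].
    move: a Ua; rewrite /bproj/= in xh; rewrite xh => a Ua.
    by exists (existT _ h a).
  by exists (restr_incl b).
- move=> b; exact: (continuous_comp (@restr_incl_continuous b) (cnorm _)).
- apply: continuous_restr.
  pose j (p : bpairs restr_topBundle) : bpairs B :=
    existT _ (sgval (projT1 p)) (projT2 p).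
  have cj : continuous (j : initial_topology (@bpairs_incl _ _ restr_topBundle)
      -> initial_topology (@bpairs_incl _ _ B)).
    apply: continuous_initial => p.
    exact: (continuous_comp (@initial_continuous _ _
      (@bpairs_incl _ _ restr_topBundle) p) (@restr_incl2_continuous _)).
  by move=> p; exact: (continuous_comp (cj p) (cadd _)).
- move=> z; apply: continuous_restr => b.
  exact: (continuous_comp (@restr_incl_continuous b) (cscale z _)).
- move=> F h FF F0 Fh; apply: cvg_restr_incl; apply: cvg0.
    exact: F0.
  exact: (cvg_comp (@bproj _ _ restr_topBundle) (@sgval G H) Fh
    (@sgval_continuous G H h)).
Qed.

End TopBundle.

Variable B : fellBundle R G.

Let rfiber (h : H) := fiber (restr_topBundle B) h.
Let rmul (h k : H) (a : rfiber h) (b : rfiber k) : rfiber (h * k)%g :=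
  fb_mul a b.
Let rstar (h : H) (a : rfiber h) : rfiber h^-1%g := fb_star a.

Let rmul_continuous : continuous
  (fun p : bundle_space (restr_topBundle B) * bundle_space (restr_topBundle B) =>
     bpt (rmul (bvec p.1) (bvec p.2))).
Proof.
apply: continuous_restr => p.
exact: (continuous_comp (@restr_incl2_continuous B p)
  (@fb_mul_continuous _ _ B _)).
Qed.

Let rstar_continuous : continuous
  (fun b : bundle_space (restr_topBundle B) => bpt (rstar (bvec b))).
Proof.
apply: continuous_restr => b.
exact: (continuous_comp (@restr_incl_continuous _ b)
  (@fb_star_continuous _ _ B _)).
Qed.

Let rmulA (x y z : H) (a : rfiber x) (b : rfiber y) (c : rfiber z) :
  bpt (rmul (rmul a b) c) = bpt (rmul a (rmul b c)).
Proof. by apply: restr_incl_inj; exact: fb_mulA. Qed.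

Let rstarM (x y : H) (a : rfiber x) (b : rfiber y) :
  bpt (rstar (rmul a b)) = bpt (rmul (rstar b) (rstar a)).
Proof. by apply: restr_incl_inj; exact: fb_starM. Qed.

Let rstarK (x : H) (a : rfiber x) : bpt (rstar (rstar a)) = bpt a.
Proof. by apply: restr_incl_inj; exact: fb_starK. Qed.

Let rpositive (x : H) (a : rfiber x) : exists c : rfiber 1%g,
  bpt (rmul (rstar a) a) = bpt (rmul (rstar c) c).
Proof.
have [c ac] := fb_positive a.
by exists c; apply: restr_incl_inj; exact: ac.
Qed.

Definition restriction : fellBundle R H :=
  @FellBundle R H (restr_topBundle B) (restr_is_banach_bundle (fb_banach B))
    rmul rstar (fun h k => @fb_mulDl _ _ B (sgval h) (sgval k))
    (fun h k => @fb_mulDr _ _ B (sgval h) (sgval k))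
    (fun h k => @fb_mulZl _ _ B (sgval h) (sgval k))
    (fun h k => @fb_mulZr _ _ B (sgval h) (sgval k))
    rmulA
    (fun h k => @fb_mul_norm _ _ B (sgval h) (sgval k))
    rmul_continuous
    (fun h => @fb_starD _ _ B (sgval h)) (fun h => @fb_starZ _ _ B (sgval h))
    rstarM rstarK rstar_continuous (fun h => @fb_cstar _ _ B (sgval h))
    rpositive.

Definition restr_section (Delta : G -> R) (delta : H -> R)
    (f : forall x, fiber B x) (h : H) : fiber restriction h :=
  (Num.sqrt (Delta (sgval h)) * (Num.sqrt (delta h))^-1)%:C *: f (sgval h).

End Restriction.

Section Representations.
Context (R : realType).

Record hilbertSpace := HilbertSpace {
  hs_space :> completeNormedModType R[i];
  hs_dot : {dot hs_space for (@Num.conj R[i])};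
  hs_norm : forall v : hs_space, `|v| ^+ 2 = hs_dot v v
}.

Context (G : topGroupType).

Record starRep (B : fellBundle R G) (X : hilbertSpace) := StarRep {
  rep_op :> forall x : G, fiber B x -> X -> X;
  rep_linear : forall (x : G) (a : fiber B x), linear (rep_op a);
  rep_bounded : forall (x : G) (a : fiber B x), continuous (rep_op a);
  rep_fiberD : forall (x : G) (a b : fiber B x) (v : X),
    rep_op (a + b) v = rep_op a v + rep_op b v;
  rep_fiberZ : forall (x : G) (z : R[i]) (a : fiber B x) (v : X),
    rep_op (z *: a) v = z *: rep_op a v;
  rep_mul : forall (x y : G) (a : fiber B x) (b : fiber B y) (v : X),
    rep_op (fb_mul a b) v = rep_op a (rep_op b v);
  rep_star : forall (x : G) (a : fiber B x) (v w : X),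
    hs_dot X (rep_op (fb_star a) v) w = hs_dot X v (rep_op a w);
  rep_strongly_continuous : forall v : X,
    continuous (fun b : bundle_space B => rep_op (bvec b) v)
}.

Definition lin_span (V : lmodType R[i]) (A : set V) : set V :=
  [set w | exists n (c : 'I_n -> R[i]) (a : 'I_n -> V),
    (forall i, A (a i)) /\ w = \sum_(i < n) c i *: a i].

Definition nondegenerate_rep (B : fellBundle R G) (X : hilbertSpace)
    (S : starRep B X) :=
  closure (lin_span [set w : X | exists x (a : fiber B x) v, w = S x a v])
    = setT.

Definition rep_integral (mu : {measure set (borel G) -> \bar R})
    (B : fellBundle R G) (X : hilbertSpace) (S : starRep B X)
    (phi : forall x, fiber B x) (v : X) : X :=
  bochner_integral mu (fun x : borel G => S x (phi x) v).

Definition positive_op (X : hilbertSpace) (A : X -> X) :=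
  forall v : X, 0 <= hs_dot X (A v) v.

End Representations.

Definition bundle_positive (R : realType) (G : topGroupType)
    (H : closedSubgroup G)
    (mu : {measure set (borel G) -> \bar R})
    (nu : {measure set (borel H) -> \bar R})
    (Delta : G -> R) (delta : H -> R) (B : fellBundle R G) (X : hilbertSpace R)
    (S : starRep (restriction H B) X) :=
  forall f : (forall x, fiber B x), cc_section f ->
    positive_op (rep_integral nu S
      (restr_section Delta delta (section_conv mu (section_star Delta f) f))).

(* Main.v *)
Require Import Defs.
From mathcomp Require Import all_boot all_order all_algebra.
From mathcomp Require Import complex finmap.
From mathcomp Require Import all_classical all_reals all_analysis.
From mathcomp Require Import measurable_realfun ring lra.

Set Implicit Arguments.
Unset Strict Implicit.
Unset Printing Implicit Defensive.

Import Order.TTheory GRing.Theory Num.Theory.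
Import numFieldNormedType.Exports.

Local Open Scope classical_set_scope.
Local Open Scope ring_scope.
Local Open Scope complex_scope.

(** Write [w = (Delta / delta)^(1/2)] on [H].  For [f] in [L(B)] and [v] in [X],
    inverting the variable in the convolution gives
    [<S_(p(f^* * f)) v, v> =
       int_G int_H w(h) <S_(f(y)^* f(y h)) v, v> dh dy].
    Choose [theta >= 0] on [G] whose integral over each coset [y H] that meets
    the support of [f] is [1]; inserting it and translating the variables turns
    this into
    [int_G theta(y) int_H int_H <S_(u(k)^* u(h)) v, v> dk dh dy] with
    [u(h) = w(h) f(y h)], whose inner double integral is a limit of finite sums
    [sum_(i, j) <S_(b_i^* b_j) xi_j, xi_i>] with [b_i] in [B_(y h_i)].

    These sums are nonnegative.  Let [P = (S_(b_i^* b_j))_(i, j)] on [X^n] and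
    let [a = sum_j b_j b_j^*], acting on each fibre by left multiplication.
    Each [S_(d^* d)] is positive because [d^* d = c^* c] with [c] in [B_e], so
    [[d, d'] = <S_(d^* d') xi, xi>] is a semi-inner product on a fibre; [a] is
    positive for it, since [[a d, d]] is the sum of the [<S_(e^* e) xi, xi>] for
    [e = b_j^* d].  Hence [s - a] is a contraction up to the factor [s], for [s]
    large.  As [P^2] comes from [b_i^* a b_j], the vectors [(s - P)^k P xi] are
    the [S_(b_i^* (s - a)^k b_j) xi_j] summed over [j], of norm [O(s^k)]; so
    [(s - P)^k xi] has norm [O(k s^k)].  Norms of powers of a symmetric operator
    are log-convex, so [|(s - P) xi| <= s |xi|], which gives [<P xi, xi> >= 0]. *)

(** * Integration of compactly supported functions *)

(** The [b_i] lie over points of one coset [y H], in general outside [H]. So [S] cannot be applied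
    to them, and [S_(b_i^* b_j)] does not factor through operators [S_(b_i)]; nor does the
    positivity axiom, which concerns a single [a^* a], speak of matrices. What remains is that [a]
    maps each single fibre to itself, where the axiom does apply. Square roots and spectral theory
    are replaced by growth rates of iterates, which are insensitive to constants. Growth is known
    only along [P xi], because only vectors with entries [sum_j S_(b_i^* d_j) xi_j] can be followed
    inside the fibres.

    All exchanges of integrals are scalar: real functionals [u -> Re (z <u, v>)] are moved through
    both Bochner integrals beforehand. The square root in [w] is what balances the modular
    functions: [w] is multiplicative, so translating the inner integral over [H] by [k] leaves
    [w(k)^2 = Delta(k) / delta(k)], which is exactly the factor produced by a right translation in
    [G] followed by an inversion in [H]. *)

Section CompactSupport.
Context (R : realType) (T : ptopologicalType).
Variable mu : {measure set (borel T) -> \bar R}.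
Hypothesis hausT : hausdorff_space T.
Hypothesis mu_compact : forall K : set T, compact K -> (mu K < +oo)%E.
Implicit Types (f g : T -> R) (K : set T).

Lemma open_measurable_borel (U : set T) :
  open U -> measurable (U : set (borel T)).
Proof. exact: sub_sigma_algebra. Qed.

Lemma compact_measurable_borel K : compact K -> measurable (K : set (borel T)).
Proof.
move=> cK; rewrite -[K]setCK; apply: measurableC; apply: open_measurable_borel.
by apply: closed_openC; exact: compact_closed.
Qed.

Lemma continuous_measurable_borel f :
  continuous f -> measurable_fun [set: borel T] (f : borel T -> R).
Proof.
move=> cf; apply: (measurability _ (RGenOpens.measurableE R)).
move=> _ [_ [a [b ->]] <-]; rewrite setTI.
apply: open_measurable_borel; move/continuousP: cf; apply.
exact: interval_open.
Qed.

Lemma bounded_integrable f K M : compact K ->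
  measurable_fun [set: borel T] (f : borel T -> R) ->
  (forall x, f x != 0 -> K x) -> (forall x, `|f x| <= M) ->
  mu.-integrable [set: borel T] (EFin \o f).
Proof.
move=> cK mf fK fM; have mK := compact_measurable_borel cK.
have -> : f = (f : borel T -> R) \_ K.
  apply/funext => x; rewrite patchE; case: ifPn => // /negP xK.
  by apply/eqP; apply: contraPT xK => /fK Kx; apply; rewrite inE.
rewrite -restrict_EFin; apply/integrable_restrict => //=; rewrite setTI.
apply: measurable_bounded_integrable => //; first exact: mu_compact.
  exact: measurable_funS mf.
exists M; split; first exact: num_real.
by move=> x Mx y _; apply: le_trans (fM y) (ltW Mx).
Qed.

Lemma normr_Rintegral_le f K M : compact K ->
  measurable_fun [set: borel T] (f : borel T -> R) ->
  (forall x, f x != 0 -> K x) -> (forall x, `|f x| <= M) ->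
  `|\int[mu]_x f x| <= M * fine (mu K).
Proof.
move=> cK mf fK fM; have mK := compact_measurable_borel cK.
have intf := bounded_integrable cK mf fK fM.
apply: le_trans (le_normr_Rintegral measurableT intf) _.
rewrite -Rintegral_cst // [leRHS]Rintegral_mkcond.
have cM : forall x, `|((fun=> M) \_ K) x| <= M.
  by move=> x; rewrite patchE; case: ifP => _; rewrite ?normr0 ?ger0_norm //;
     apply: le_trans (fM x).
apply: le_Rintegral => //.
- exact: integrable_norm.
- apply: (bounded_integrable cK _ _ cM).
    by apply/measurable_restrict => //; rewrite setTI; exact: measurable_cst.
  by move=> x; rewrite patchE; case: ifP => [|_]; rewrite ?inE ?eqxx.
- move=> x _; rewrite patchE; case: ifPn => // xK.
  have [->|/fK] := eqVneq (f x) 0; first by rewrite normr0.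
  by move: xK; rewrite notin_setE.
Qed.

Lemma continuous_bounded f K : continuous f -> compact K ->
  (forall x, f x != 0 -> K x) -> exists M, forall x, `|f x| <= M.
Proof.
move=> cf cK fK.
have cfK : compact (f @` K).
  apply: continuous_compact => //; apply: continuous_subspaceT; exact: cf.
have [M [_ HM]] := compact_bounded cfK.
exists (`|M| + 1) => x.
have [->|fx0] := eqVneq (f x) 0; first by rewrite normr0 addr_ge0.
apply: HM; last by exists x => //; exact: fK.
by rewrite (le_lt_trans (ler_norm _)) // ltrDl.
Qed.

Lemma cc_integrable f K : continuous f -> compact K ->
  (forall x, f x != 0 -> K x) -> mu.-integrable [set: borel T] (EFin \o f).
Proof.
move=> cf cK fK; have [M fM] := continuous_bounded cf cK fK.
by apply: (bounded_integrable cK _ fK fM); exact: continuous_measurable_borel.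
Qed.

(** A finite subcover by the interiors of the [U x], made disjoint by removing from each set the
    earlier ones. The point [c i] lies in [K] but not necessarily in [A i], which may be empty. *)
Lemma compact_partition K (U : T -> set T) : compact K ->
  (forall x, K x -> nbhs x (U x)) ->
  exists n (A : 'I_n -> set T) (c : 'I_n -> T),
    [/\ forall i, measurable (A i : set (borel T)), forall i, A i `<=` U (c i),
        forall i, K (c i), trivIset setT A & \bigcup_i A i = K].
Proof.
move=> cK KU; have mK := compact_measurable_borel cK.
have := cK; rewrite compact_cover => /(_ T K (fun x => (U x)°)) [].
- by move=> x _; exact: open_interior.
- by move=> x Kx; exists x => //; exact: KU.
move=> D DK KD.
pose s := enum_fset D.
pose V (i : nat) : set T := (U (nth point s i))°.
pose B i : set T := K `&` V i `\` \bigcup_(j in `I_i) V j.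
have mB i : measurable (B i : set (borel T)).
  apply: measurableD.
    by apply: measurableI => //; apply: open_measurable_borel;
      exact: open_interior.
  apply: open_measurable_borel; apply: bigcup_open => j _; exact: open_interior.
have sK i : (i < size s)%N -> K (nth point s i).
  by move=> si; apply/set_mem; apply: DK; apply: mem_nth.
exists (size s), (fun i => B i), (fun i => nth point s i); split => //.
- by move=> i x [[_ /interior_subset]].
- by move=> i; exact: sK.
- apply/trivIsetP => i j _ _ ij; apply/seteqP; split => // x [[[_ Vi] ni] [[_
    Vj] nj]].
  have [ij'|ji|e] := ltngtP i j; last by move: ij; rewrite (val_inj e) eqxx.
    by apply: nj; exists i.
  by apply: ni; exists j.
- apply/seteqP; split => [x [i _ [[]]]//|x Kx].
  have [y /= yD Uyx] := KD _ Kx.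
  have ex : exists i, (i < size s)%N && (x \in V i).
    by exists (index y s); rewrite index_mem yD/= /V nth_index// inE.
  case: (ex_minnP ex) => m /andP[ms xm] mmin.
  exists (Ordinal ms) => //=; split; first by split => //; exact/set_mem.
  move=> [j /= jm Vj]; have := mmin j; rewrite (ltn_trans jm ms) mem_set//.
  by move=> /(_ erefl); rewrite leqNgt jm.
Qed.

(** The sum is the integral of the step function equal to [f (c i)] on [A i], which is within [e] of
    [f]. Asking only for measurability and allowing [e = 0] covers the indicator of [K], for which
    this is additivity of the measure over the partition. *)
Lemma Riemann_sum_approx f K n (A : 'I_n -> set T) (c : 'I_n -> T) (e : R) :
  measurable_fun [set: borel T] (f : borel T -> R) ->
  compact K -> (forall x, f x != 0 -> K x) ->
  (forall i, measurable (A i : set (borel T))) -> trivIset setT A ->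
  \bigcup_i A i = K -> 0 <= e ->
  (forall i x, A i x -> `|f x - f (c i)| <= e) ->
  `|\int[mu]_x f x - \sum_(i < n) fine (mu (A i)) * f (c i)| <= e * fine (mu K).
Proof.
move=> mf cK fK mA tA AK e0 fe.
have mK := compact_measurable_borel cK.
pose s x : R := \sum_(i < n) f (c i) * \1_(A i) x.
have AiK i : A i `<=` K by rewrite -AK; exact: bigcup_sup.
have muA i : (mu (A i) < +oo)%E.
  by apply: le_lt_trans (mu_compact cK); apply: le_measure; rewrite ?inE.
have ms : measurable_fun [set: borel T] (s : borel T -> R).
  apply: measurable_sum => i; apply: measurable_funM => //.
have sE i x : A i x -> s x = f (c i).
  move=> Ax; rewrite /s (bigD1 i)//= indicE mem_set// mulr1 big1 ?addr0// => j
    ji.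
  rewrite indicE memNset ?mulr0// => Ajx.
  have /trivIsetP/(_ j i I I ji) ji0 := tA.
  by suff : (A j `&` A i) x by rewrite ji0.
have s0 x : ~ K x -> s x = 0.
  move=> nK; rewrite /s big1// => i _; rewrite indicE memNset ?mulr0//.
  by move=> /AiK.
have fs x : `|f x - s x| <= e.
  have [Kx|nK] := pselect (K x).
    move: (Kx); rewrite -AK => -[i _ Ax]; rewrite (sE i)//; exact: fe.
  have [->|/fK//] := eqVneq (f x) 0.
  by rewrite s0// subrr normr0.
have fsK x : f x - s x != 0 -> K x.
  move=> h; apply: contrapT => nK; move: h; rewrite s0// subr0.
  by move=> /fK.
have ifs : mu.-integrable [set: borel T] (EFin \o (f \- s)).
  apply: (bounded_integrable cK _ fsK fs); exact: measurable_funB.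
have iind i : mu.-integrable [set: borel T] (EFin \o (fun x => f (c i) * \1_(A
  i) x)).
  apply: (@bounded_integrable _ K `|f (c i)|) => //.
  - exact: measurable_funM.
  - move=> x; rewrite indicE; case: (boolP (x \in A i)); rewrite ?mulr0 ?eqxx//.
    by move=> /set_mem /AiK.
  - by move=> x; rewrite normrM ler_piMr// indicE; case: (_ \in _);
      rewrite ?normr1 ?normr0.
have is_ : mu.-integrable [set: borel T] (EFin \o s).
  rewrite (_ : EFin \o s = (fun x => \sum_(i < n) (f (c i) * \1_(A i) x)%:E)%E).
    by apply: integrable_sum => // i _; exact: iind.
  by apply/funext => x; rewrite /= /s sumEFin.
have -> : \sum_(i < n) fine (mu (A i)) * f (c i) = \int[mu]_x s x.
  rewrite /Rintegral; under eq_integral do rewrite /s -sumEFin.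
  rewrite integral_sum// -EFin_sum_fine; last by move=> i _;
    apply: integrable_fin_num => //; exact: iind.
  apply: eq_bigr => i _.
  have := @RintegralZl _ _ _ mu [set: borel T] (\1_(A i) : T -> R) (f (c i))
    measurableT.
  rewrite {1}/Rintegral => ->.
    by rewrite mulrC /Rintegral integral_indic// setIT.
  apply: (@bounded_integrable _ K 1) => //.
  - by move=> x; rewrite indicE; case: (boolP (x \in A i));
      rewrite ?eqxx// => /set_mem /AiK.
  - by move=> x; rewrite indicE; case: (_ \in _); rewrite ?normr1 ?normr0.
have if_ : mu.-integrable [set: borel T] (EFin \o f).
  suff -> : EFin \o f = (fun x => (EFin \o (f \- s)%R) x + (EFin \o s) x)%E.
    exact: integrableD.
  by apply/funext => x /=; rewrite -EFinD subrK.
rewrite -RintegralB//; apply: normr_Rintegral_le => //.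
exact: measurable_funB.
Qed.

End CompactSupport.

Section ContinuityOfCompositions.
Context (S T U : topologicalType).

Lemma cont_comp (h : T -> U) (k : S -> T) :
  continuous h -> continuous k -> continuous (fun s => h (k s)).
Proof.
by move=> ch ck s; apply: (@continuous_comp _ _ _ k h); [exact: ck|exact: ch].
Qed.

Lemma cont_pair (h : S -> T) (k : S -> U) :
  continuous h -> continuous k -> continuous (fun s => (h s, k s)).
Proof. by move=> ch ck s; apply: cvg_pair; [exact: ch|exact: ck]. Qed.

Lemma cont_fst : continuous (fst : S * T -> S).
Proof. by move=> p; exact: cvg_fst. Qed.

Lemma cont_snd : continuous (snd : S * T -> T).
Proof. by move=> p; exact: cvg_snd. Qed.

Lemma cont_mul (R : realType) (h k : S -> R) :
  continuous h -> continuous k -> continuous (fun s => h s * k s).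
Proof. by move=> ch ck s; apply: cvgM; [exact: ch|exact: ck]. Qed.

Lemma cont_inv (R : realType) (h : S -> R) : continuous h ->
  (forall s, h s != 0) -> continuous (fun s => (h s)^-1).
Proof. by move=> ch h0 s; apply: cvgV; [exact: h0|exact: ch]. Qed.

End ContinuityOfCompositions.

(** * Integrals depending on a parameter and exchange of integrals *)

Section TwoVariables.
Context (R : realType).

(** The near-covering form of compactness reduces the claim to a neighbourhood of each [(y, t0)], on
    which both values of [F] are within [e / 2] of [F (y, t0)]. *)
Lemma near_uniform_compact (Y T : topologicalType) (F : Y * T -> R) (K : set Y)
    (t0 : T) (e : R) : continuous F -> compact K -> 0 < e ->
  \forall t \near t0, forall y, K y -> `|F (y, t) - F (y, t0)| < e.
Proof.
move=> cF cK e0.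
move/compact_near_coveringP : (cK); apply => y Ky.
have e20 : 0 < e / 2 by rewrite divr_gt0.
have [[A B] /= [yA tB] AB] : nbhs (y, t0) [set p | `|F (y, t0) - F p| < e / 2].
  by have /cvgrPdist_lt /(_ _ e20) := cF (y, t0).
exists (A, B) => // -[y' t] /= [Ay' Bt].
have h1 := AB (y', t) (conj Ay' Bt).
have h2 := AB (y', t0) (conj Ay' (nbhs_singleton tB)).
rewrite [ltRHS](splitr e) (le_lt_trans (ler_distD (F (y, t0)) _ _))//.
by rewrite ltrD// distrC.
Qed.

Lemma continuous_fixl (Y T U : topologicalType) (F : Y * T -> U) (y : Y) :
  continuous F -> continuous (fun t => F (y, t)).
Proof.
move=> cF t; apply: (@continuous_comp _ _ _ (fun t => (y, t)) F);
  last exact: cF.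
by apply: cvg_pair; [exact: cvg_cst|exact: cvg_id].
Qed.

Lemma continuous_fixr (Y T U : topologicalType) (F : Y * T -> U) (t : T) :
  continuous F -> continuous (fun y => F (y, t)).
Proof.
move=> cF y; apply: (@continuous_comp _ _ _ (fun y => (y, t)) F);
  last exact: cF.
by apply: cvg_pair; [exact: cvg_id|exact: cvg_cst].
Qed.

Lemma continuous_swap (Y T U : topologicalType) (F : Y * T -> U) :
  continuous F -> continuous (fun p : T * Y => F (p.2, p.1)).
Proof.
move=> cF p; apply: (@continuous_comp _ _ _ (fun p : T * Y => (p.2, p.1)) F);
  last exact: cF.
by apply: cvg_pair; [exact: cvg_snd|exact: cvg_fst].
Qed.

(** The supports need to lie in one compact set only for [y] near [y0]; in a locally compact group
    this holds for translates of a compactly supported function. *)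
Lemma continuous_Rintegral (Y : topologicalType) (T : ptopologicalType)
    (nu : {measure set (borel T) -> \bar R}) (F : Y * T -> R) (L : set T) (y0 :
      Y) :
  hausdorff_space T -> (forall K : set T, compact K -> (nu K < +oo)%E) ->
  continuous F -> compact L ->
  (\forall y \near y0, forall t, F (y, t) != 0 -> L t) ->
  {for y0, continuous (fun y => \int[nu]_t F (y, t))}.
Proof.
move=> hT nuK cF cL sF; apply/cvgrPdist_lt => e e0.
have nuL0 : 0 <= fine (nu L) by rewrite fine_ge0.
pose d := e / (fine (nu L) + 1).
have d0 : 0 < d by rewrite divr_gt0// ltr_wpDl.
have cF' := continuous_swap cF.
have near_d := near_uniform_compact y0 cF' cL d0.
have s0 := nbhs_singleton sF.
have int y : (forall t, F (y, t) != 0 -> L t) ->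
    nu.-integrable [set: borel T] (EFin \o (fun t => F (y, t))).
  by apply: cc_integrable => //; exact: continuous_fixl.
near=> y.
have sy : forall t, F (y, t) != 0 -> L t by near: y.
have dy : forall t, L t -> `|F (y, t) - F (y0, t)| < d by near: y.
rewrite -RintegralB//; [|exact: int..].
have supp t : F (y0, t) - F (y, t) != 0 -> L t.
  have [->|/s0//] := eqVneq (F (y0, t)) 0.
  by rewrite sub0r oppr_eq0 => /sy.
apply: (@le_lt_trans _ _ (d * fine (nu L))).
  apply: normr_Rintegral_le => //.
    by apply: measurable_funB; apply: continuous_measurable_borel;
      exact: continuous_fixl.
  move=> t; rewrite distrC.
  have [->|] := eqVneq (F (y, t) - F (y0, t)) 0; first by rewrite normr0 ltW.
  by rewrite -oppr_eq0 opprB => /supp /dy/ltW.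
by rewrite /d mulrAC ltr_pdivrMr ?ltr_wpDl// ltr_pM2l// ltrDl.
Unshelve. all: by end_near. Qed.

Section Fubini.
Context (S T : ptopologicalType).
Variables (mu : {measure set (borel S) -> \bar R}).
Variables (nu : {measure set (borel T) -> \bar R}).
Hypotheses (hS : hausdorff_space S) (hT : hausdorff_space T).
Hypothesis mu_compact : forall K : set S, compact K -> (mu K < +oo)%E.
Hypothesis nu_compact : forall K : set T, compact K -> (nu K < +oo)%E.
Variables (F : S * T -> R) (K : set S) (L : set T).
Hypotheses (cF : continuous F) (cK : compact K) (cL : compact L).
Hypothesis sF : forall x y, F (x, y) != 0 -> K x /\ L y.

Let int_neq0 x : \int[nu]_y F (x, y) != 0 -> K x.
Proof.
move=> h; apply: contrapT => nK; move: h.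
have F0 y : F (x, y) = 0.
  by apply: contrapT => /eqP /sF[].
by under eq_Rintegral do rewrite F0; rewrite Rintegral_cst// mul0r eqxx.
Qed.

Let int_neq0' y : \int[mu]_x F (x, y) != 0 -> L y.
Proof.
move=> h; apply: contrapT => nL; move: h.
have F0 x : F (x, y) = 0.
  by apply: contrapT => /eqP /sF[].
by under eq_Rintegral do rewrite F0; rewrite Rintegral_cst// mul0r eqxx.
Qed.

Let cont1 : continuous (fun x => \int[nu]_y F (x, y)).
Proof.
move=> x; apply: (continuous_Rintegral (L := L)) => //.
by near=> x' => y /sF[].
Unshelve. all: by end_near. Qed.

Let cont2 : continuous (fun y => \int[mu]_x F (x, y)).
Proof.
move=> y; apply: (continuous_Rintegral (F := fun p => F (p.2, p.1)) (L := K))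
  => //.
  exact: continuous_swap.
by near=> x' => x /sF[].
Unshelve. all: by end_near. Qed.

(* The product sigma-algebra of two Borel sigma-algebras can be smaller than the
   Borel sigma-algebra of the product, and Haar measures need not be
   sigma-finite, so that Fubini-Tonelli does not apply: both sides are
   approximated by Riemann sums over a partition of [L] instead. *)
Lemma Rintegral_exchange :
  \int[mu]_x \int[nu]_y F (x, y) = \int[nu]_y \int[mu]_x F (x, y).
Proof.
apply/eqP; rewrite -subr_eq0 -normr_eq0 eq_le normr_ge0 andbT.
have m0 : 0 <= fine (mu K) by rewrite fine_ge0.
have n0 : 0 <= fine (nu L) by rewrite fine_ge0.
(* Each iterated integral differs from the common sum [s] by at most [d * mu K * nu L], so the total
   error is [d * (c - 1) <= e]; the [+ 1] keeps [c] positive. *)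
pose c := 2 * (fine (mu K) * fine (nu L)) + 1.
have c0 : 0 < c by rewrite ltr_wpDl// !mulr_ge0.
apply/ler_addgt0Pr => e e0; rewrite add0r.
pose d := e / c; have d0 : 0 < d by rewrite divr_gt0.
have [n [A [p [mA AU _ tA AL]]]] := compact_partition hT cL
  (fun y (_ : L y) => near_uniform_compact y cF cK d0).
have FA i y x : A i y -> `|F (x, y) - F (x, p i)| <= d.
  move=> /AU /= h; have [/h/ltW//|nK] := pselect (K x).
  have F0 z : F (x, z) = 0 by apply: contrapT => /eqP /sF[].
  by rewrite !F0 subrr normr0 ltW.
have mFx x : measurable_fun [set: borel T] (fun y : borel T => F (x, y)).
  by apply: continuous_measurable_borel; exact: continuous_fixl.
have mFy y : measurable_fun [set: borel S] (fun x : borel S => F (x, y)).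
  apply: continuous_measurable_borel.
  exact: continuous_fixr.
have iFy y : mu.-integrable [set: borel S] (EFin \o (fun x => F (x, y))).
  apply: (cc_integrable hS mu_compact _ cK) => //; last by move=> x /sF[].
  exact: continuous_fixr.
pose s := \sum_(i < n) fine (nu (A i)) * \int[mu]_x F (x, p i).
have h2 : `|\int[nu]_y \int[mu]_x F (x, y) - s| <= d * fine (mu K) * fine (nu
  L).
  apply: (Riemann_sum_approx hT nu_compact _ cL _ mA tA AL) => //.
  - exact: continuous_measurable_borel.
  - by rewrite mulr_ge0// ltW.
  - move=> i y Ay; rewrite -RintegralB//.
    apply: normr_Rintegral_le => //; first exact: measurable_funB.
      move=> x h; apply: contrapT => nK; move/eqP: h; apply.
      have F0 z : F (x, z) = 0 by apply: contrapT => /eqP /sF[].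
      by rewrite !F0 subrr.
    by move=> x; exact: FA.
have h1 : `|\int[mu]_x \int[nu]_y F (x, y) - s| <= d * fine (nu L) * fine (mu
  K).
  have iFs i : mu.-integrable [set: borel S]
      (EFin \o (fun x => fine (nu (A i)) * F (x, p i))).
    by have := integrableZl measurableT (fine (nu (A i))) (iFy (p i)).
  have iFS : mu.-integrable [set: borel S]
      (EFin \o (fun x => \sum_(i < n) fine (nu (A i)) * F (x, p i))).
    suff -> : EFin \o (fun x => \sum_(i < n) fine (nu (A i)) * F (x, p i)) =
        (fun x => \sum_(i < n) (fine (nu (A i)) * F (x, p i))%:E)%E.
      by apply: integrable_sum => // i _; exact: iFs.
    by apply/funext => x /=; rewrite sumEFin.
  have -> : s = \int[mu]_x \sum_(i < n) fine (nu (A i)) * F (x, p i).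
    rewrite /Rintegral; under eq_integral do rewrite -sumEFin.
    rewrite integral_sum// -EFin_sum_fine; last first.
      by move=> i _; apply: integrable_fin_num => //; exact: iFs.
    by apply: eq_bigr => i _; rewrite -RintegralZl.
  rewrite -RintegralB//; last first.
    exact: cc_integrable mu_compact _ _ cont1 cK int_neq0.
  apply: normr_Rintegral_le => //.
  - apply: measurable_funB; first exact: continuous_measurable_borel.
    by apply: measurable_sum => i; apply: measurable_funM.
  - move=> x h; apply: contrapT => nK; move/eqP: h; apply.
    have F0 z : F (x, z) = 0 by apply: contrapT => /eqP /sF[].
    rewrite big1 ?subr0; last by move=> i _; rewrite F0 mulr0.
    by apply/eqP; apply: contrapT => /negP /int_neq0.
  - move=> x; apply: (Riemann_sum_approx hT nu_compact _ cL _ mA tA AL) => //.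
    + by move=> y /sF[].
    + exact: ltW.
    + by move=> i y; exact: FA.
rewrite -(subrK s (\int[mu]_x _)) -addrA (le_trans (ler_normD _ _))//.
rewrite (distrC s) (le_trans (lerD h1 h2))//.
have -> : d * fine (nu L) * fine (mu K) + d * fine (mu K) * fine (nu L) =
  d * (c - 1) by rewrite /c; ring.
by rewrite /d mulrAC ler_pdivrMr// ler_pM2l// gerBl.
Qed.

End Fubini.
End TwoVariables.

(** * Haar measures and modular functions *)

Section GroupTopology.
Context (T : topGroupType).
Implicit Types (K L : set T).

Lemma continuous_mulg (S : topologicalType) (f g : S -> T) :
  continuous f -> continuous g -> continuous (fun s => (f s * g s)%g).
Proof.
move=> cf cg s.
apply: (@continuous_comp _ _ _ (fun s => (f s, g s)) (fun p : T * T => (p.1 *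
  p.2)%g)).
  by apply: cvg_pair; [exact: cf|exact: cg].
exact: mulg_continuous.
Qed.

Lemma continuous_invg (S : topologicalType) (f : S -> T) :
  continuous f -> continuous (fun s => (f s)^-1%g).
Proof.
move=> cf s; apply: (@continuous_comp _ _ _ f (fun x : T => x^-1%g));
  first exact: cf.
exact: invg_continuous.
Qed.

Lemma continuous_mulgl (x : T) : continuous (fun y => (x * y)%g).
Proof. by apply: continuous_mulg => y; [exact: cvg_cst|exact: cvg_id]. Qed.

Lemma continuous_mulgr (x : T) : continuous (fun y => (y * x)%g).
Proof. by apply: continuous_mulg => y; [exact: cvg_id|exact: cvg_cst]. Qed.

Lemma compact_mulg K L : compact K -> compact L ->
  compact [set (p.1 * p.2)%g | p in K `*` L].
Proof.
move=> cK cL; apply: continuous_compact; last exact: compact_setX.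
by apply: continuous_subspaceT; exact: mulg_continuous.
Qed.

Lemma compact_invg K : compact K -> compact [set x | K x^-1%g].
Proof.
move=> cK; have -> : [set x | K x^-1%g] = (fun x : T => x^-1%g) @` K.
  apply/seteqP; split => [x /= Kx|x /= [y Ky <-]]; last by rewrite invgK.
  by exists x^-1%g => //; rewrite invgK.
by apply: continuous_compact => //; apply: continuous_subspaceT;
  exact: invg_continuous.
Qed.

End GroupTopology.

(** * Compactly supported bump functions *)

Section Bump.
Context (R : realType) (T : ptopologicalType).
Hypothesis hausT : hausdorff_space T.
Hypothesis lcT : locally_compact [set: T].

Lemma compact_nbhs_exists (x : T) : exists2 K : set T, nbhs x K & compact K.
Proof.
by have [K] := @lcT x I; rewrite withinET => xK [cK _]; exists K.
Qed.

Let local_bump (x : T) : exists f : T -> R,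
  [/\ continuous f, forall y, 0 <= f y, (\forall y \near x, 1 <= f y) &
      exists2 K, compact K & forall y, f y != 0 -> K y].
Proof.
have [K xK cK] := compact_nbhs_exists x.
have : uniform_separator [set x] (~` K°).
  apply: (@locally_compact_completely_regular T R) => //.
    by apply: open_closedC; exact: open_interior.
move=> /(@uniform_separatorP _ R)[f [cf f01 fx fK]].
have fx0 : f x = 0 by apply: fx; exists x.
(* The separating function is 0 at [x] and 1 off the interior of [K]. The factor 2 gives the value 2
   at [x], hence at least 1 on a whole neighbourhood. *)
have cg : continuous (fun y => 2 * (1 - f y)).
  move=> y; apply: cvgMr; apply: cvgB; [exact: cvg_cst|exact: cf].
exists (fun y => 2 * (1 - f y)); split => //.
- move=> y; rewrite mulr_ge0// subr_ge0.
  by have := f01 (f y); rewrite set_itvcc /=; move=> /(_ (imageT _ _)) /andP[].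
- have := @cvgr_ge _ _ _ _ (fun y => 2 * (1 - f y)) _ (cg x) 1.
  by apply; rewrite fx0 subr0 mulr1 ltr1n.
- exists K => // y; apply: contraPP => nKy; rewrite (fK (f y)) ?subrr ?mulr0
    ?eqxx//.
  by exists y => // /interior_subset.
Qed.

Lemma compact_bump (K : set T) : compact K -> exists f : T -> R,
  [/\ continuous f, forall y, 0 <= f y, forall y, K y -> 1 <= f y &
      exists2 L, compact L & forall y, f y != 0 -> L y].
Proof.
move=> cK.
have /choice[g gP] := local_bump.
have gx x : nbhs x [set y | 1 <= g x y] by have [] := gP x.
have [n [A [c [_ AU _ _ AK]]]] := compact_partition hausT cK
  (fun x (_ : K x) => gx x).
exists (fun y => \sum_(i < n) g (c i) y); split.
- by apply: continuous_big => [|i _]; [exact: add_continuous|have [] := gP (c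
    i)].
- by move=> y; apply: sumr_ge0 => i _; have [] := gP (c i).
- move=> y; rewrite -AK => -[i _ /AU h]; rewrite (bigD1 i)//= (le_trans h)//
    lerDl.
  by apply: sumr_ge0 => j _; have [] := gP (c j).
- have /choice[L LP] : forall i, exists L, compact L /\ forall y, g (c i) y !=
    0 -> L y.
    by move=> i; have [_ _ _ [L cL gL]] := gP (c i); exists L.
  exists (\big[setU/set0]_(i < n) L i).
    by apply: bigsetU_compact => i _; exact: (LP i).1.
  move=> y h; apply: contrapT => nL; move/eqP : h; apply; apply: big1 => i _.
  apply/eqP; apply: contrapT => /negP /(LP i).2 Ly; apply: nL.
  by rewrite (bigD1 i)//=; left.
Qed.

End Bump.

(** * Translation, inversion and the modular function *)

Section Haar.
Context (R : realType) (T : topGroupType).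
Variables (mu : {measure set (borel T) -> \bar R}) (Delta : T -> R).
Hypothesis hausT : hausdorff_space T.
Hypothesis lcT : locally_compact [set: T].
Hypothesis haar : left_haar mu.
Implicit Types (f g : T -> R) (K : set T).

Lemma measurable_mulgl (x : T) :
  measurable_fun [set: borel T] ((fun y => (x * y)%g) : borel T -> borel T).
Proof.
apply: (@measurability _ _ (borel T) (borel T) setT _ open erefl) => _ [U oU
  <-]; rewrite setTI.
apply: open_measurable_borel; apply: open_comp => // y _.
exact: continuous_mulgl.
Qed.

(** The pushforward of [mu] under left translation by [x] is [mu], the preimage of [A] being the
    translate [x^-1 A]. *)
Lemma Rintegral_mulgl f K (x : T) : continuous f -> compact K ->
  (forall y, f y != 0 -> K y) -> \int[mu]_y f (x * y)%g = \int[mu]_y f y.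
Proof.
move=> cf cK fK; congr fine.
pose t : borel T -> borel T := (fun y => (x * y)%g).
have mt : measurable_fun [set: borel T] t by exact: measurable_mulgl.
have muK := haar_compact haar.
have cft : continuous (fun y => f (x * y)%g).
  move=> y; apply: (@continuous_comp _ _ _ (fun y => (x * y)%g) f);
    last exact: cf.
  exact: continuous_mulgl.
have cKx : compact [set (p.1 * p.2)%g | p in [set x^-1%g] `*` K].
  by apply: compact_mulg => //; exact: compact_set1.
have ift : mu.-integrable [set: borel T] (EFin \o (fun y => f (x * y)%g)).
  apply: (cc_integrable hausT muK cft cKx) => y /fK Ky.
  by exists (x^-1%g, (x * y)%g) => //=; rewrite mulKg.
transitivity (\int[pushforward mu t]_y (EFin \o f) y)%E.
  rewrite (@integral_pushforward _ _ _ _ _ t mt mu setT (EFin \o f))//=.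
  by apply/measurable_EFinP; exact: continuous_measurable_borel.
apply: eq_measure_integral => A mA _; rewrite /pushforward.
transitivity (mu [set (x^-1 * y)%g | y in (A : set T)]);
  last exact: haar_left_invariant.
congr (mu _); apply/seteqP; split => [y /= Ay|_ [y /= Ay <-]].
  by exists (x * y)%g => //; rewrite mulKg.
by rewrite /t /= mulVKg.
Qed.

(** Otherwise inner regularity on the open set of all points would make the whole group null. *)
Lemma compact_mu_gt0 : exists2 K : set T, compact K & 0 < fine (mu K).
Proof.
apply: contrapT => h.
have mK K : compact K -> mu K = 0%E.
  move=> cK; have fK : mu K \is a fin_num.
    by rewrite ge0_fin_numE ?measure_ge0//; exact: (haar_compact haar).
  apply/eqP; rewrite -(fineK fK) eqe; apply/eqP; apply: contrapT => /eqP nz.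
  by apply: h; exists K => //; rewrite lt_neqAle eq_sym nz fine_ge0.
have := haar_neq0 haar; rewrite (haar_inner_regular haar openT) => /eqP; apply.
rewrite [X in ereal_sup X](_ : _ = [set 0%E]) ?ereal_sup1//.
apply/seteqP; split => [_ [K [cK _] <-]|_ ->]; first exact: mK.
by exists set0; [split; [exact: compact0|]|exact: measure0].
Qed.

(** A test function of positive integral: identities for [Delta] are read off from its translates by
    cancelling that integral. *)
Lemma haar_bump : exists g : T -> R, [/\ continuous g,
  exists2 K, compact K & forall y, g y != 0 -> K y & 0 < \int[mu]_y g y].
Proof.
have [K cK K0] := compact_mu_gt0.
have [g [cg g0 g1 [L cL gL]]] := compact_bump R hausT lcT cK.
exists g; split => //; first by exists L.
rewrite (lt_le_trans K0)// /Rintegral fine_le//.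
- by rewrite ge0_fin_numE//; exact: (haar_compact haar).
- by apply: integrable_fin_num => //; exact: cc_integrable (haar_compact haar)
    _ _ cg cL gL.
have mK := compact_measurable_borel hausT cK.
have iK : mu K = (\int[mu]_y (\1_K y)%:E)%E by rewrite integral_indic// setIT.
rewrite iK; apply: ge0_le_integral => //.
- by apply/measurable_EFinP; exact: measurable_indic.
- by apply/measurable_EFinP; exact: continuous_measurable_borel.
- move=> y _; rewrite lee_fin indicE; case: (boolP (y \in K)) =>
    [/set_mem/g1//|_].
  exact: g0.
Qed.

Hypothesis modD : is_modular mu Delta.

Lemma modular_gt0 y : 0 < Delta y. Proof. exact: modD.1. Qed.

Lemma Rintegral_mulgr f K (y : T) : continuous f -> compact K ->
  (forall x, f x != 0 -> K x) ->
  \int[mu]_x f (x * y)%g = (Delta y)^-1 * \int[mu]_x f x.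
Proof. by move=> cf cK fK; apply: modD.2 => //; exists K. Qed.

Lemma modularM x y : Delta (x * y)%g = Delta x * Delta y.
Proof.
have [g [cg [K cK gK] g0]] := haar_bump.
have := Rintegral_mulgr (x * y)%g cg cK gK.
under eq_Rintegral do rewrite mulgA.
have cgy : continuous (fun z => g (z * y)%g).
  move=> z; apply: (@continuous_comp _ _ _ (fun z => (z * y)%g) g);
    last exact: cg.
  exact: continuous_mulgr.
have cKy := compact_mulg cK (@compact_set1 _ y^-1%g).
rewrite (Rintegral_mulgr x cgy cKy); last first.
  by move=> z /gK h; exists ((z * y)%g, y^-1%g) => //=; rewrite mulgK.
rewrite (Rintegral_mulgr y cg cK gK) mulrA => /(mulIf (lt0r_neq0 g0)) /(congr1
  GRing.inv).
by rewrite invfM !invrK => <-; rewrite mulrC.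
Qed.

Lemma modular1 : Delta 1%g = 1.
Proof.
have := modularM 1%g 1%g; rewrite mulg1 -{1}[Delta _]mulr1.
by move=> /(mulfI (lt0r_neq0 (modular_gt0 _))).
Qed.

Lemma modularV x : Delta x^-1%g = (Delta x)^-1.
Proof.
apply: (mulIf (lt0r_neq0 (modular_gt0 x))).
by rewrite -modularM mulVg modular1 mulVf// lt0r_neq0// modular_gt0.
Qed.

(** On a test function, [Delta y] is the inverse of a quotient whose numerator is an integral with
    parameter [y]. For [y] in a compact neighbourhood [N], the integrands are supported in
    [K N^-1]. *)
Lemma modular_continuous : continuous Delta.
Proof.
have [g [cg [K cK gK] g0]] := haar_bump.
have DE y : Delta y = (\int[mu]_x g (x * y)%g / \int[mu]_x g x)^-1.
  by rewrite (Rintegral_mulgr y cg cK gK) mulfK ?invrK// lt0r_neq0.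
have cF : continuous (fun p : T * T => g (p.2 * p.1)%g).
  move=> p; apply: (@continuous_comp _ _ _ (fun p : T * T => (p.2 * p.1)%g) g);
    last exact: cg.
  by apply: continuous_mulg => q; [exact: cvg_snd|exact: cvg_fst].
have cI : continuous (fun y => \int[mu]_x g (x * y)%g).
  move=> y0; have [N yN cN] := compact_nbhs_exists lcT y0.
  have cL := compact_mulg cK (compact_invg cN).
  apply: (continuous_Rintegral hausT (haar_compact haar) cF cL).
  near=> y => x /gK /= h; exists ((x * y)%g, y^-1%g); last by rewrite /= mulgK.
  by split => //=; rewrite invgK; near: y.
move=> y; rewrite (_ : Delta = fun y => (\int[mu]_x g (x * y)%g / \int[mu]_x g
  x)^-1).
  apply: cvgV; last by apply: cvgMl; exact: cI.
  by rewrite -[X in X != 0]invrK -DE invr_neq0// lt0r_neq0// modular_gt0.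
exact/funext.
Unshelve. all: by end_near. Qed.

(** Uniqueness of Haar measure is avoided: both sides are multiplied by the integral of a test
    function [g], after which left translations, two exchanges and one right translation of [g]
    suffice, the modular factors cancelling. *)
Lemma Rintegral_invg f K : continuous f -> compact K ->
  (forall x, f x != 0 -> K x) ->
  \int[mu]_x (f x^-1%g * (Delta x)^-1) = \int[mu]_x f x.
Proof.
move=> cf cK fK; have muK := haar_compact haar.
have [g [cg [L cL gL] g0]] := haar_bump.
have Dn0 x : Delta x != 0 by rewrite lt0r_neq0// modular_gt0.
have cD := modular_continuous.
have cV (S : topologicalType) (h : S -> T) :
  continuous h -> continuous (fun s => (Delta (h s))^-1).
  by move=> ch; apply: cont_inv => //; exact: cont_comp cD ch.
have cj : continuous (fun x => f x^-1%g * (Delta x)^-1).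
  apply: cont_mul; last by apply: cV => x; exact: cvg_id.
  by apply: cont_comp => //; exact: invg_continuous.
(* [F (x, y)] is [g x] times the integrand of the left side translated by [x^-1]; [F2 (y, x)] is
   [F (y x, y)], in which [Delta y] has cancelled. *)
pose F (p : T * T) := g p.1 * Delta p.1 * (f (p.2^-1 * p.1)%g * (Delta p.2)^-1).
have cF : continuous F.
  apply: cont_mul; first by apply: cont_mul; [exact: cont_comp cg (@cont_fst _
    _)|exact: cont_comp cD (@cont_fst _ _)].
  apply: cont_mul; last exact: (cV _ snd (@cont_snd _ _)).
  apply: (cont_comp (h := f) (k := fun p : T * T => (p.2^-1 * p.1)%g)) => //.
  apply: continuous_mulg; [apply: continuous_invg;
    exact: cont_snd|exact: cont_fst].
pose F2 (p : T * T) := g (p.1 * p.2)%g * (Delta p.2 * f p.2).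
have cF2 : continuous F2.
  apply: cont_mul; last by apply: cont_mul; [exact: cont_comp cD (@cont_snd _
    _)|exact: cont_comp cf (@cont_snd _ _)].
  apply: (cont_comp (h := g) (k := fun p : T * T => (p.1 * p.2)%g)) => //.
  by apply: continuous_mulg; [exact: cont_fst|exact: cont_snd].
have sF x y : F (x, y) != 0 -> L x /\ [set (p.1 * p.2)%g | p in L `*` [set x |
  K x^-1%g]] y.
  rewrite /F /= mulf_eq0 negb_or => /andP[]; rewrite mulf_eq0 negb_or =>
    /andP[/gL Lx _].
  rewrite mulf_eq0 negb_or => /andP[/fK Ky _]; split => //.
  by exists (x, (x^-1 * y)%g) => /=; [split => //=;
    rewrite invgM invgK|rewrite mulVKg].
have sF2 y x : F2 (y, x) != 0 -> [set (p.1 * p.2)%g | p in L `*` [set x | K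
  x^-1%g]] y /\ K x.
  rewrite /F2 /= mulf_eq0 negb_or => /andP[/gL Ly].
  rewrite mulf_eq0 negb_or => /andP[_ /fK Kx]; split => //.
  by exists ((y * x)%g, x^-1%g); [split => //=; rewrite invgK|rewrite /= mulgK].
have cLK := compact_mulg cL (compact_invg cK).
apply: (mulfI (lt0r_neq0 g0)).
set J := \int[mu]_x (f x^-1%g * (Delta x)^-1).
have ig := cc_integrable hausT muK cg cL gL.
have if_ := cc_integrable hausT muK cf cK fK.
transitivity (\int[mu]_x \int[mu]_y F (x, y)).
  rewrite -RintegralZr//; apply: eq_Rintegral => x _.
  rewrite /J -(Rintegral_mulgl x^-1%g cj (compact_invg cK)); last first.
    by move=> y; rewrite mulf_eq0 negb_or => /andP[/fK].
  rewrite -RintegralZl//; last first.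
    apply: (cc_integrable hausT muK _ (compact_mulg (@compact_set1 _ x)
      (compact_invg cK))).
      exact: cont_comp cj (@continuous_mulgl _ _).
    move=> y; rewrite mulf_eq0 negb_or => /andP[/fK h _].
    by exists (x, (x^-1 * y)%g) => //=; rewrite mulVKg.
  apply: eq_Rintegral => y _; rewrite /F /= modularM modularV !invgM invgK
    invfM invrK.
  by ring.
rewrite (Rintegral_exchange hausT hausT muK muK cF cL cLK sF).
transitivity (\int[mu]_y \int[mu]_x F2 (y, x)).
  apply: eq_Rintegral => y _.
  rewrite -(@Rintegral_mulgl _ L y (continuous_fixr cF) cL); last first.
    by move=> x /sF[].
  apply: eq_Rintegral => x _; rewrite /F /F2 /= modularM mulKg.
  by have := Dn0 y; move=> ?; field.
rewrite (Rintegral_exchange hausT hausT muK muK cF2 cLK cK sF2).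
rewrite -RintegralZl//; apply: eq_Rintegral => x _.
rewrite /F2 /= RintegralZr//; last first.
  apply: (cc_integrable hausT muK _ (compact_mulg cL (@compact_set1 _ x^-1%g))).
    by apply: cont_comp => //; exact: continuous_mulgr.
  by move=> y /gL h; exists ((y * x)%g, x^-1%g) => //=; rewrite mulgK.
by rewrite (Rintegral_mulgr x cg cL gL); have := Dn0 x; move=> ?; field.
Qed.

End Haar.

(** * Closed subgroups *)

Section Subgroup.
Context (G : topGroupType) (H : closedSubgroup G).

Lemma sgval_hausdorff : hausdorff_space G -> hausdorff_space H.
Proof.
move=> hG x y xy; apply: sgval_inj; apply: hG => U V Ux Vy.
have [z [Uz Vz]] := xy _ _ (sgval_continuous Ux) (sgval_continuous Vy).
by exists (sgval z).
Qed.

(** Closedness of [H] enters here: a filter on [H] that contains the preimage of [K] clusters in [G]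
    at a point of [K], and closedness puts this point in [H]. *)
Lemma compact_sgval_preimage (K : set G) : compact K ->
  compact [set h : H | K (sgval h)].
Proof.
move=> cK F FF FK.
have [x [Kx Fx]] : K `&` cluster (@sgval G H @ F) !=set0 by apply: cK.
have Hx : csg_set H x.
  apply: (@csg_closed _ H) => U Ux.
  have [y [Hy Uy]] : (csg_set H `&` U) !=set0.
    apply: Fx => //; rewrite /nbhs /=.
    by apply: filterS filterT => h _ /=; exact/set_mem/sgvalP.
  by exists y.
have [h hx] : exists h : H, sgval h = x.
  by exists (exist _ x (mem_set Hx) : subgroup_type H).
exists h; split; first by rewrite /= hx.
move=> A B FA [_ [[U oU <-] Uh UB]].
have Ux : nbhs x U by apply: open_nbhs_nbhs; split => //; rewrite -hx.
have FA' : (@sgval G H @ F) (@sgval G H @` A).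
  have : F (@sgval G H @^-1` (@sgval G H @` A)) by apply: filterS FA;
    exact: preimage_image.
  exact.
have [_ [[a Aa <-] Ua]] := Fx _ _ FA' Ux.
by exists a; split => //; exact: UB.
Qed.

Lemma sgval_locally_compact : hausdorff_space G -> locally_compact [set: G] ->
  locally_compact [set: H].
Proof.
move=> hG lG h _; rewrite withinET.
have [K hK cK] := compact_nbhs_exists lG (sgval h).
exists [set h : H | K (sgval h)]; first exact: sgval_continuous.
have cH := compact_sgval_preimage cK; split => //.
exact: compact_closed (sgval_hausdorff hG) cH.
Qed.

Lemma compact_sgval_image (L : set H) : compact L -> compact (@sgval G H @` L).
Proof.
move=> cL; apply: continuous_compact => //.
by apply: continuous_subspaceT; exact: sgval_continuous.
Qed.

End Subgroup.

(** * Integrals of positive definite kernels *)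

Section PositiveDefinite.
Context (R : realType) (T : ptopologicalType).
Variable nu : {measure set (borel T) -> \bar R}.
Hypothesis hausT : hausdorff_space T.
Hypothesis nu_compact : forall K : set T, compact K -> (nu K < +oo)%E.

(** Both variables use the same partition and the same points [p i], so that the double Riemann sum
    is the quadratic form of the hypothesis with coefficients [nu (A i)]. *)
Lemma posdef_Rintegral_ge0 (F : T * T -> R) (L : set T) :
  continuous F -> compact L -> (forall x y, F (x, y) != 0 -> L x /\ L y) ->
  (forall n (p : 'I_n -> T) (c : 'I_n -> R),
    0 <= \sum_(i < n) \sum_(j < n) c i * c j * F (p i, p j)) ->
  0 <= \int[nu]_x \int[nu]_y F (x, y).
Proof.
move=> cF cL sF pF.
have n0 : 0 <= fine (nu L) by rewrite fine_ge0.
pose C := 2 * (fine (nu L) * fine (nu L)) + 1.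
have C0 : 0 < C by rewrite ltr_wpDl// !mulr_ge0.
apply/ler_addgt0Pr => e e0.
pose d := e / C; have d0 : 0 < d by rewrite divr_gt0.
have mL := compact_measurable_borel hausT cL.
have cF' := continuous_swap cF.
have nb x : L x -> nbhs x ([set y | forall z, L z -> `|F (z, y) - F (z, x)| <
  d] `&`
    [set y | forall z, L z -> `|F (y, z) - F (x, z)| < d]).
  by move=> Lx; apply: filterI; [exact: near_uniform_compact|
    exact: (near_uniform_compact x cF' cL d0)].
have [n [A [p [mA AU pL tA AL]]]] := compact_partition hausT cL nb.
have F0 x z : ~ L x -> F (x, z) = 0.
  by move=> nL; apply: contrapT => /eqP /sF[].
have F0' x z : ~ L z -> F (x, z) = 0.
  by move=> nL; apply: contrapT => /eqP /sF[].
have F1 i y x : A i y -> `|F (x, y) - F (x, p i)| <= d.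
  move=> /AU [h _]; have [/h/ltW//|nK] := pselect (L x).
  by rewrite !F0// subrr normr0 ltW.
have F2 i x y : A i x -> `|F (x, y) - F (p i, y)| <= d.
  move=> /AU [_ h]; have [/h/ltW//|nK] := pselect (L y).
  by rewrite !F0'// subrr normr0 ltW.
have mFx x : measurable_fun [set: borel T] (fun y : borel T => F (x, y)).
  by apply: continuous_measurable_borel; exact: continuous_fixl.
have iFx x : nu.-integrable [set: borel T] (EFin \o (fun y => F (x, y))).
  apply: (cc_integrable hausT nu_compact _ cL) => //; last by move=> y /sF[].
  exact: continuous_fixl.
(* The Riemann sum of the indicator of [L], with error 0. It bounds the inner errors, which are
   added up with weights [nu (A i)]. *)
have sumA : \sum_(i < n) fine (nu (A i)) = fine (nu L).
  have i1 i : (\1_L (p i) : R) = 1 by rewrite indicE mem_set.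
  have := @Riemann_sum_approx _ _ nu hausT nu_compact (\1_L) L n A p 0.
  rewrite mul0r {1}/Rintegral integral_indic// setIT => h.
  have {h} : `|fine (nu L) - \sum_(i < n) fine (nu (A i)) * \1_L (p i)| <= 0.
    apply: h => //.
    - by move=> x; rewrite indicE; case: (boolP (x \in L));
        rewrite ?eqxx// => /set_mem.
    - move=> i x Ax; rewrite i1 indicE mem_set ?subrr ?normr0//.
      by rewrite -AL; exists i.
  rewrite normr_le0 subr_eq0 => /eqP ->.
  by apply: eq_bigr => i _; rewrite i1 mulr1.
pose Phi x := \int[nu]_y F (x, y).
have cPhi : continuous Phi.
  move=> x; apply: (continuous_Rintegral hausT nu_compact cF cL).
  by near=> x' => y /sF[].
have h1 : `|\int[nu]_x Phi x - \sum_(i < n) fine (nu (A i)) * Phi (p i)| <=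
    d * fine (nu L) * fine (nu L).
  apply: (Riemann_sum_approx hausT nu_compact _ cL _ mA tA AL) => //.
  - exact: continuous_measurable_borel.
  - move=> x h; apply: contrapT => nL; move/eqP: h; apply.
    rewrite /Phi; under eq_Rintegral do rewrite F0//.
    by rewrite Rintegral_cst// mul0r.
  - by rewrite mulr_ge0// ltW.
  - move=> i x Ax; rewrite -RintegralB//; apply: normr_Rintegral_le => //.
    + exact: measurable_funB.
    + move=> y h; apply: contrapT => nL; move/eqP: h; apply.
      by rewrite !F0'// subrr.
    + by move=> y; exact: F2.
pose s := \sum_(i < n) \sum_(j < n) fine (nu (A i)) * fine (nu (A j)) * F (p i,
  p j).
have h2 : `|\sum_(i < n) fine (nu (A i)) * Phi (p i) - s| <=
    d * fine (nu L) * fine (nu L).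
  rewrite -sumrB (le_trans (ler_norm_sum _ _ _))// -{2}sumA mulr_sumr.
  apply: ler_sum => i _.
  rewrite (eq_bigr (fun j => fine (nu (A i)) * (fine (nu (A j)) * F (p i, p
    j)))); last first.
    by move=> j _; rewrite mulrA.
  rewrite -mulr_sumr -mulrBr normrM ger0_norm ?fine_ge0// [leRHS]mulrC
    ler_wpM2l ?fine_ge0//.
  apply: (Riemann_sum_approx hausT nu_compact _ cL _ mA tA AL) => //.
  - by move=> y /sF[].
  - exact: ltW.
  - by move=> j y; exact: F1.
have s0 : 0 <= s := pF n p (fun i => fine (nu (A i))).
have : `|\int[nu]_x Phi x - s| <= e.
  rewrite -(subrK (\sum_(i < n) fine (nu (A i)) * Phi (p i)) (\int[nu]_x Phi
    x)).
  rewrite -addrA (le_trans (ler_normD _ _))// (le_trans (lerD h1 h2))//.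
  have -> : d * fine (nu L) * fine (nu L) + d * fine (nu L) * fine (nu L) =
    d * (C - 1) by rewrite /C; ring.
  by rewrite /d mulrAC ler_pdivrMr// ler_pM2l// gerBl.
rewrite ler_norml => /andP[+ _]; rewrite lerBrDl; lra.
Unshelve. all: by end_near. Qed.

End PositiveDefinite.

(** * Averaging over the cosets of the subgroup *)

Section SubgroupAverage.
Context (R : realType) (G : topGroupType) (H : closedSubgroup G).
Hypothesis hausG : hausdorff_space G.
Hypothesis lcG : locally_compact [set: G].
Variables (mu : {measure set (borel G) -> \bar R}) (Delta : G -> R).
Variables (nu : {measure set (borel H) -> \bar R}) (delta : H -> R).
Hypotheses (haar_mu : left_haar mu) (modDelta : is_modular mu Delta).
Hypotheses (haar_nu : left_haar nu) (moddelta : is_modular nu delta).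

Let muK := haar_compact haar_mu.
Let nuK := haar_compact haar_nu.
Let hausH : hausdorff_space H := @sgval_hausdorff G H hausG.
Let lcH : locally_compact [set: H] := @sgval_locally_compact G H hausG lcG.
Let D0 x : 0 < Delta x := modular_gt0 modDelta x.
Let d0 h : 0 < delta h := modular_gt0 moddelta h.
Let cD : continuous Delta := modular_continuous hausG lcG haar_mu modDelta.
Let cd : continuous delta := modular_continuous hausH lcH haar_nu moddelta.

Definition restr_weight (h : H) : R :=
  Num.sqrt (Delta (sgval h)) * (Num.sqrt (delta h))^-1.

Lemma restr_weight_gt0 h : 0 < restr_weight h.
Proof. by rewrite mulr_gt0// ?invr_gt0 sqrtr_gt0. Qed.

Lemma restr_weight_sqr h : restr_weight h ^+ 2 = Delta (sgval h) / delta h.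
Proof. by rewrite exprMn exprVn !sqr_sqrtr// ltW. Qed.

Lemma restr_weightM h k :
  restr_weight (h * k)%g = restr_weight h * restr_weight k.
Proof.
rewrite /restr_weight (modularM hausH lcH haar_nu moddelta).
rewrite (_ : sgval (h * k)%g = (sgval h * sgval k)%g)//.
rewrite (modularM hausG lcG haar_mu modDelta) !sqrtrM ?ltW// invfM.
by rewrite mulrACA.
Qed.

Lemma restr_weight_continuous : continuous restr_weight.
Proof.
have cs : continuous (@Num.sqrt R) by exact: sqrt_continuous.
apply: (@cont_mul H R (fun h => Num.sqrt (Delta (sgval h))) (fun h => (Num.sqrt
  (delta h))^-1)).
  exact: (@cont_comp H G R (fun x => Num.sqrt (Delta x)) (@sgval G H)
    (cont_comp cs cD)
    (@sgval_continuous G H)).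
apply: (cont_inv (cont_comp cs cd)) => h; by rewrite lt0r_neq0// sqrtr_gt0.
Qed.

Let w := restr_weight.

(** In the application [kappa (y, h)] is the real part of [z <S(f(y)^* f(y h)) v, v>] and [K]
    contains the support of [f]. The last hypothesis is then positive definiteness on the coset
    [y H], its kernel being formed from [f(y l_i)^* f(y l_j)]. *)
Variables (kappa : G * H -> R) (K : set G).
Hypotheses (ck : continuous kappa) (cK : compact K).
Hypothesis sk : forall y h, kappa (y, h) != 0 -> K y /\ K (y * sgval h)%g.
Hypothesis pk : forall (y : G) n (l : 'I_n -> H) (c : 'I_n -> R),
  0 <= \sum_(i < n) \sum_(j < n)
    c i * c j * kappa ((y * sgval (l i))%g, ((l i)^-1 * l j)%g).

(* [sub P Q] contains every [h] in [H] such that some [y] in [P] has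
   [y * h] in [Q]. *)
Let sub (P Q : set G) : set H :=
  [set h : H | [set (p.1 * p.2)%g | p in [set x | P x^-1%g] `*` Q] (sgval h)].
Let sub_compact P Q : compact P -> compact Q -> compact (sub P Q).
Proof.
move=> cP cQ; apply: compact_sgval_preimage; apply: compact_mulg => //.
exact: compact_invg.
Qed.
Let subP (P Q : set G) y (h : H) : P y -> Q (y * sgval h)%g -> sub P Q h.
Proof.
move=> Py Qh; exists (y^-1%g, (y * sgval h)%g) => /=; last by rewrite mulKg.
by split => //=; rewrite invgK.
Qed.

Let cwk : continuous (fun p : G * H => w p.2 * kappa p).
Proof. exact: cont_mul (cont_comp restr_weight_continuous (@cont_snd _ _)) ck.
Qed.

Let A y := \int[nu]_h (w h * kappa (y, h)).

Let wk_neq0 y h : w h * kappa (y, h) != 0 -> K y /\ sub K K h.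
Proof.
rewrite mulf_eq0 negb_or => /andP[_ /sk [Ky Kyh]]; split => //.
exact: subP Ky Kyh.
Qed.

Let cA : continuous A.
Proof.
move=> y; apply: (continuous_Rintegral hausH nuK cwk (sub_compact cK cK)).
by near=> y' => h /wk_neq0[].
Unshelve. all: by end_near. Qed.

Let sA y : A y != 0 -> K y.
Proof.
move=> h; apply: contrapT => nK; move/eqP: h; apply.
rewrite /A; under eq_Rintegral => h _.
  rewrite (_ : w h * kappa (y, h) = 0); last by apply: contrapT => /eqP
    /wk_neq0[].
  over.
by rewrite Rintegral_cst// mul0r.
Qed.

(** Translating [h] by [k^-1] turns [w h] into [w (k^-1 h)], and multiplicativity of [w] brings out
    the factor [(w k)^-1]. *)
Let A_shift y (k : H) :
  A (y * sgval k)%g =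
  (w k)^-1 * \int[nu]_h (w h * kappa ((y * sgval k)%g, (k^-1 * h)%g)).
Proof.
have wk0 : w k != 0 by rewrite lt0r_neq0// restr_weight_gt0.
have cwy : continuous (fun h => w h * kappa ((y * sgval k)%g, h)).
  exact: (continuous_fixl cwk).
rewrite /A -(Rintegral_mulgl hausH haar_nu k^-1%g cwy (sub_compact cK cK));
  last first.
  by move=> h /wk_neq0[].
rewrite -RintegralZl//; last first.
  apply: (cc_integrable hausH nuK _ (compact_mulg (@compact_set1 _ k)
    (sub_compact cK cK))).
    apply: cont_mul; first exact: restr_weight_continuous.
    apply: (cont_comp ck); apply: (@cont_pair H G H (fun=> (y * sgval k)%g));
      first exact: cst_continuous.
    exact: continuous_mulgl.
  move=> h; rewrite mulf_eq0 negb_or => /andP[_ /sk [K1 K2]].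
  by exists (k, (k^-1 * h)%g) => /=; [split => //;
    exact: subP K1 K2|rewrite mulVKg].
apply: eq_Rintegral => h _; rewrite mulrA; congr (_ * _).
by rewrite -[in RHS](mulVKg k h) /w (restr_weightM k) mulKf.
Qed.

(** On the left the weights are symmetric in [k] and [h], as positive definiteness requires; on the
    right stands [w k ^+ 2], the quotient of the modular functions. *)
Let inner_shift y (k : H) :
  \int[nu]_h (w k * w h * kappa ((y * sgval k)%g, (k^-1 * h)%g)) =
  w k * (w k * A (y * sgval k)%g).
Proof.
have wk0 : w k != 0 by rewrite lt0r_neq0// restr_weight_gt0.
rewrite A_shift mulVKf// -RintegralZl//.
  by apply: eq_Rintegral => h _; rewrite mulrA.
apply: (cc_integrable hausH nuK _ (compact_mulg (@compact_set1 _ k)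
  (sub_compact cK cK))).
  apply: cont_mul; first exact: restr_weight_continuous.
  apply: (cont_comp ck); apply: (@cont_pair H G H (fun=> (y * sgval k)%g));
    first exact: cst_continuous.
  exact: continuous_mulgl.
move=> h; rewrite mulf_eq0 negb_or => /andP[_ /sk [K1 K2]].
by exists (k, (k^-1 * h)%g) => /=; [split => //; exact: subP K1 K2|rewrite
  mulVKg].
Qed.

Let inner_ge0 y : 0 <=
  \int[nu]_k \int[nu]_h (w k * w h * kappa ((y * sgval k)%g, (k^-1 * h)%g)).
Proof.
pose F (p : H * H) := w p.1 * w p.2 * kappa ((y * sgval p.1)%g, (p.1^-1 *
  p.2)%g).
have cF : continuous F.
  have cy : continuous (fun p : H * H => (y * sgval p.1)%g).
    exact: cont_comp (@continuous_mulgl _ y) (cont_comp (@sgval_continuous G H)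
      (@cont_fst _ _)).
  have cont_inv' : continuous (fun p : H * H => (p.1^-1 * p.2)%g).
    exact: continuous_mulg (continuous_invg (@cont_fst _ _)) (@cont_snd _ _).
  have cw (f : H * H -> H) : continuous f -> continuous (fun p => w (f p)).
    exact: (cont_comp restr_weight_continuous).
  exact: cont_mul (cont_mul (cw _ (@cont_fst _ _)) (cw _ (@cont_snd _ _)))
    (cont_comp ck (cont_pair cy cont_inv')).
have cL : compact (sub [set y] K) by apply: sub_compact => //;
  exact: compact_set1.
apply: (posdef_Rintegral_ge0 hausH nuK cF cL) => [k h|n p c].
  rewrite /F mulf_eq0 negb_or => /andP[_ /sk /= [K1 K2]]; split;
    apply: (@subP _ _ y) => //.
  move: K2; rewrite (_ : sgval (k^-1 * h)%g = ((sgval k)^-1 * sgval h)%g)//.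
  by rewrite -mulgA mulVKg.
have := pk y p (fun i => c i * w (p i)); congr (_ <= _).
apply: eq_bigr => i _; apply: eq_bigr => j _; rewrite /F /=; ring.
Qed.

(* Averaging over the cosets of [H] needs no measure on [G / H]: [theta] is a
   function whose integrals over the cosets that meet [K] are [1]. *)
Lemma Rintegral_average_ge0 : 0 <= \int[mu]_y A y.
Proof.
have [L cL L0] := compact_mu_gt0 haar_nu.
(* With [phi >= 1] on [K L], the coset integral [D y] is at least [nu L > 0] for [y] in [K]. *)
have cKL := compact_mulg cK (compact_sgval_image cL).
have [phi [cphi phi0 phi1 [P cP sphi]]] := compact_bump R hausG lcG cKL.
have cmul : continuous (fun p : G * H => (p.1 * sgval p.2)%g).
  exact: continuous_mulg (@cont_fst _ _) (cont_comp (@sgval_continuous G H)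
    (@cont_snd _ _)).
have cphim : continuous (fun p : G * H => phi (p.1 * sgval p.2)%g).
  exact: cont_comp cphi cmul.
pose D y := \int[nu]_k phi (y * sgval k)%g.
have iphi y : nu.-integrable [set: borel H] (EFin \o (fun k => phi (y * sgval
  k)%g)).
  apply: (cc_integrable hausH nuK (continuous_fixl cphim)
    (sub_compact (@compact_set1 _ y) cP)) => k /sphi h.
  exact: (@subP _ _ y).
have cDD : continuous D.
  move=> y; have [N yN cN] := compact_nbhs_exists lcG y.
  apply: (continuous_Rintegral hausH nuK cphim (sub_compact cN cP)).
  near=> z => k /sphi Pzk; apply: (@subP _ _ z) => //; near: z; exact: yN.
have mL := compact_measurable_borel hausH cL.
have DK y : K y -> fine (nu L) <= D y.
  move=> Ky; have iL : fine (nu L) = \int[nu]_k \1_L k.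
    by rewrite /Rintegral integral_indic// setIT.
  rewrite iL; apply: le_Rintegral => //.
    apply: (bounded_integrable hausH nuK cL (M := 1)) => //.
      by move=> k; rewrite indicE; case: (boolP (k \in L));
        rewrite ?eqxx// => /set_mem.
    by move=> k; rewrite indicE; case: (_ \in _); rewrite ?normr1 ?normr0.
  move=> k _; rewrite indicE; case: (boolP (k \in L)) => [/set_mem Lk|_];
    last exact: phi0.
  by apply: phi1; exists (y, sgval k) => //; split => //; exists k.
have DH y (h : H) : D (y * sgval h)%g = D y.
  rewrite /D -(Rintegral_mulgl hausH haar_nu h (@continuous_fixl _ _ _ _ y
    cphim)
     (sub_compact (@compact_set1 _ y) cP)).
    by apply: eq_Rintegral => k _; rewrite -mulgA.
  by move=> k /sphi ?; exact: (@subP _ _ y).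
(* [D] may vanish on cosets that miss [K]. The maximum is continuous, positive everywhere and
   constant on cosets, and it equals [D] on those that meet [K]. *)
pose m y := Num.max (D y) (fine (nu L)).
have m0 y : 0 < m y by rewrite lt_max L0 orbT.
pose theta y := phi y / m y.
have cm : continuous m.
  by move=> y; apply: continuous_max; [exact: cDD|exact: cvg_cst].
have ctheta : continuous theta.
  apply: cont_mul => //; apply: cont_inv => // y; exact: lt0r_neq0.
have stheta y : theta y != 0 -> P y.
  by rewrite mulf_eq0 negb_or => /andP[/sphi].
have theta0 y : 0 <= theta y by rewrite divr_ge0// ltW.
have theta1 y : K y -> \int[nu]_k theta (y * sgval k)%g = 1.
  move=> Ky; rewrite /theta; under eq_Rintegral => k _.
    rewrite /m DH; over.
  rewrite RintegralZr// (max_idPl (DK _ Ky)).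
  by rewrite divff// lt0r_neq0// (lt_le_trans L0 (DK _ Ky)).
have cthm : continuous (fun p : G * H => theta (p.1 * sgval p.2)%g).
  exact: cont_comp ctheta cmul.
have iA := cc_integrable hausG muK cA cK sA.
have -> : \int[mu]_y A y = \int[mu]_y \int[nu]_k (theta (y * sgval k)%g * A y).
  apply: eq_Rintegral => y _.
  rewrite RintegralZr//; last first.
    apply: (cc_integrable hausH nuK (@continuous_fixl _ _ _ _ y cthm)
      (sub_compact (@compact_set1 _ y) cP)) => k /stheta h.
    exact: (@subP _ _ y).
  have [->|/sA/theta1 ->] := eqVneq (A y) 0; first by rewrite mulr0.
  by rewrite mul1r.
have cF1 : continuous (fun p : G * H => theta (p.1 * sgval p.2)%g * A p.1).
  exact: cont_mul cthm (cont_comp cA (@cont_fst _ _)).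
have sF1 y k : theta (y * sgval k)%g * A y != 0 -> K y /\ sub K P k.
  rewrite mulf_eq0 negb_or => /andP[/stheta h /sA Ky]; split => //.
  exact: subP Ky h.
rewrite (Rintegral_exchange hausG hausH muK nuK cF1 cK (sub_compact cK cP) sF1)
  /=.
pose F2 (p : H * G) := (Delta (sgval p.1))^-1 * (theta p.2 * A (p.2 * (sgval
  p.1)^-1)%g).
have cF2 : continuous F2.
  have cD' : continuous (fun p : H * G => (Delta (sgval p.1))^-1).
    apply: cont_inv => [|p]; last exact: lt0r_neq0.
    exact: cont_comp cD (cont_comp (@sgval_continuous G H) (@cont_fst _ _)).
  have cA' : continuous (fun p : H * G => A (p.2 * (sgval p.1)^-1)%g).
    apply: (cont_comp cA (k := fun p : H * G => (p.2 * (sgval p.1)^-1)%g)).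
    exact: continuous_mulg (@cont_snd _ _) (continuous_invg (cont_comp
      (@sgval_continuous G H) (@cont_fst _ _))).
  exact: cont_mul cD' (cont_mul (cont_comp ctheta (@cont_snd _ _)) cA').
have sF2 k y : F2 (k, y) != 0 -> sub K P k /\ P y.
  rewrite /F2 /= mulf_eq0 negb_or => /andP[_]; rewrite mulf_eq0 negb_or.
  move=> /andP[/stheta Py /sA h]; split => //.
  by apply: (subP h); rewrite -mulgA mulVg mulg1.
have E k : \int[mu]_y (theta (y * sgval k)%g * A y) = \int[mu]_y F2 (k, y).
  have cf : continuous (fun y => theta y * A (y * (sgval k)^-1)%g).
    exact: cont_mul ctheta (cont_comp cA (@continuous_mulgr _ _)).
  rewrite /F2 /= RintegralZl//; last first.
    by apply: (cc_integrable hausG muK cf cP) => y;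
      rewrite mulf_eq0 negb_or => /andP[/stheta].
  rewrite -(Rintegral_mulgr modDelta (sgval k) cf cP); last first.
    by move=> y; rewrite mulf_eq0 negb_or => /andP[/stheta].
  by apply: eq_Rintegral => y _; rewrite mulgK.
under eq_Rintegral do rewrite E.
rewrite (Rintegral_exchange hausH hausG nuK muK cF2 (sub_compact cK cP) cP sF2).
apply: Rintegral_ge0 => y _.
(* Inverting [k] turns [(Delta k)^-1] into [Delta k] and contributes [(delta k)^-1]. The product is
   [w k ^+ 2], so [inner_shift] applies. *)
rewrite -(Rintegral_invg hausH lcH haar_nu moddelta (continuous_fixr cF2)
  (sub_compact cK cP)); last by move=> k /sF2[].
rewrite (_ : \int[nu]_k _ = \int[nu]_k (theta y * (w k * (w k * A (y * sgval
  k)%g)))).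
  rewrite RintegralZl//.
    rewrite mulr_ge0//; have := inner_ge0 y.
    by under eq_Rintegral do rewrite inner_shift.
  have cwA : continuous (fun k => w k * (w k * A (y * sgval k)%g)).
    have cw := restr_weight_continuous.
    exact: cont_mul cw (cont_mul cw (cont_comp cA (cont_comp (@continuous_mulgl
      _ y) (@sgval_continuous G H)))).
  apply: (cc_integrable hausH nuK cwA (sub_compact (@compact_set1 _ y) cK)) =>
    k.
  rewrite !mulf_eq0 !negb_or => /and3P[_ _ /sA h]; exact: (@subP _ _ y).
apply: eq_Rintegral => k _.
rewrite /F2 /= (_ : sgval k^-1%g = (sgval k)^-1%g)// invgK.
rewrite (modularV hausG lcG haar_mu modDelta) invrK.
have -> : w k * (w k * A (y * sgval k)%g) = Delta (sgval k) / delta k * A (y *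
  sgval k)%g.
  by rewrite mulrA -expr2 restr_weight_sqr.
by ring.
Unshelve. all: by end_near. Qed.

Lemma Rintegral_subgroup_ge0 :
  0 <= \int[nu]_h (w h * \int[mu]_y kappa (y, h)).
Proof.
have := Rintegral_average_ge0.
rewrite (Rintegral_exchange hausG hausH muK nuK cwk cK (sub_compact cK cK)) /=;
  last first.
  by move=> y h /wk_neq0.
congr (_ <= _); apply: eq_Rintegral => h _; rewrite RintegralZl//.
by apply: (cc_integrable hausG muK (continuous_fixr ck) cK) => y /sk[].
Qed.


Lemma subgroup_integrand_integrable :
  nu.-integrable [set: borel H] (EFin \o (fun h => w h * \int[mu]_y kappa (y,
    h))).
Proof.
have cI : continuous (fun h => w h * \int[mu]_y kappa (y, h)).
  apply: cont_mul; first exact: restr_weight_continuous.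
  move=> h; apply: (continuous_Rintegral hausG muK (continuous_swap ck) cK).
  by near=> k => y /= /sk[].
apply: (cc_integrable hausH nuK cI (sub_compact cK cK)) => h h0.
apply: contrapT => nh; move/eqP: h0; apply.
rewrite (_ : \int[mu]_y _ = \int[mu]_y (0 : R)); first by rewrite
  Rintegral_cst// mul0r mulr0.
apply: eq_Rintegral => y _; apply: contrapT => /eqP /sk [K1 K2]; apply: nh.
exact: subP K1 K2.
Unshelve. all: by end_near. Qed.

End SubgroupAverage.

(** * Positive operators on semi-inner product spaces *)

Section LogConvex.
Context (R : realType).

(** The ratios of successive terms do not decrease. If the first ratio [q] exceeded [T], then [a k]
    would be at least [q ^+ k * a 0], which outgrows [T ^+ k] times a polynomial. *)
Lemma logconvex_growth (a : nat -> R) (C T : R) : 0 < T ->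
  (forall k, 0 <= a k) -> (forall k, a k.+1 ^+ 2 <= a k * a k.+2) ->
  (forall k, a k <= C * (k.+1)%:R ^+ 2 * T ^+ k) -> a 1%N <= T * a 0%N.
Proof.
move=> T0 a0 lc aC; rewrite leNgt; apply/negP => h.
have a00 : 0 < a 0%N.
  rewrite lt_neqAle eq_sym a0 andbT; apply/eqP => e.
  have := lc 0%N; rewrite e mul0r; move: h; rewrite e mulr0 => h.
  by rewrite leNgt exprn_gt0.
pose q := a 1%N / a 0%N.
have qT : T < q by rewrite ltr_pdivlMr.
have q0 : 0 < q := lt_trans T0 qT.
have step k : 0 < a k /\ q * a k <= a k.+1.
  elim: k => [|k [ak0 IH]]; first by split => //; rewrite divfK// lt0r_neq0.
  have ak1 : 0 < a k.+1 by rewrite (lt_le_trans _ IH)// mulr_gt0.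
  split => //; rewrite -(ler_pM2l ak0) (le_trans _ (lc k))// mulrA (mulrC _ q).
  by rewrite expr2 ler_pM2r.
have ge k : q ^+ k * a 0%N <= a k.
  elim: k => [|k IH]; first by rewrite mul1r.
  by rewrite exprS -mulrA (le_trans _ (step k).2)// ler_pM2l.
pose e := q / T - 1.
have e0 : 0 < e by rewrite subr_gt0 ltr_pdivlMr// mul1r.
have qe : q = (1 + e) * T by rewrite /e addrC subrK divfK// lt0r_neq0.
have bern m : 1 + m%:R * e <= (1 + e) ^+ m.
  elim: m => [|m IH]; first by rewrite mul0r addr0.
  rewrite exprS -natr1 (le_trans _ (ler_wpM2l _ IH))//;
    last by rewrite addr_ge0// ltW.
  have : 0 <= m%:R * e ^+ 2 by rewrite mulr_ge0// sqr_ge0.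
  nra.
(* At the index [3 * m], the cube of Bernoulli's inequality grows like [m ^+ 3] and beats the
   quadratic factor. *)
have main m : (m%:R * e) ^+ 3 * a 0%N <= C * ((3 * m).+1)%:R ^+ 2.
  have := le_trans (ge (3 * m)%N) (aC (3 * m)%N).
  rewrite qe exprMn mulrAC ler_pM2r ?exprn_gt0//; apply: le_trans.
  rewrite ler_pM2r// mulnC exprM; apply: lerXn2r.
  - by rewrite nnegrE mulr_ge0// ltW.
  - by rewrite nnegrE exprn_ge0// addr_ge0// ltW.
  - by rewrite (le_trans _ (bern m))// lerDr.
have C0 : 0 <= C by have := le_trans (a0 0%N) (aC 0%N);
  rewrite expr0 expr1n !mulr1.
have d0 : 0 < e ^+ 3 * a 0%N by rewrite mulr_gt0// exprn_gt0.
(* The 16 comes from [(3 m + 1)^2 <= 16 m^2] for [m >= 1]. *)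
pose x := 16 * C / (e ^+ 3 * a 0%N).
have x0 : 0 <= x by rewrite divr_ge0 ?mulr_ge0// ltW.
have [m mx] : exists m : nat, x < m%:R.
  by exists (Num.truncn x).+1; rewrite truncnS_gt.
have m1 : (1 <= m)%N.
  by rewrite lt0n; apply/eqP => m0; move: mx; rewrite m0 ltNge x0.
have mR : (1 : R) <= m%:R by rewrite ler1n.
have := main m; apply/negP; rewrite -ltNge.
move: mx; rewrite ltr_pdivrMr// => mx.
have -> : ((3 * m).+1)%:R = 3 * m%:R + 1 :> R by rewrite -natr1 natrM.
apply: (@le_lt_trans _ _ (16 * C * m%:R ^+ 2)).
  by rewrite (mulrC 16) -mulrA ler_wpM2l//; nra.
have -> : (m%:R * e) ^+ 3 * a 0%N = m%:R * (e ^+ 3 * a 0%N) * m%:R ^+ 2 by ring.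
by rewrite ltr_pM2r// exprn_gt0// (lt_le_trans ltr01).
Qed.

End LogConvex.

(** * Real semi-inner products and symmetric operators *)

Section SemiInner.
Context (R : realType) (V : lmodType R[i]) (B : V -> V -> R).
Hypothesis Bsym : forall u v, B u v = B v u.
Hypothesis BD : forall u v x, B (u + v) x = B u x + B v x.
Hypothesis BZ : forall (r : R) u v, B (r%:C *: u) v = r * B u v.
Hypothesis Bge0 : forall u, 0 <= B u u.

Lemma formDr u v x : B x (u + v) = B x u + B x v.
Proof. by rewrite Bsym BD !(Bsym x). Qed.

Lemma formZr (r : R) u v : B v (r%:C *: u) = r * B v u.
Proof. by rewrite Bsym BZ (Bsym v). Qed.

Lemma form_quad (s t : R) u v :
  B (s%:C *: u + t%:C *: v) (s%:C *: u + t%:C *: v) =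
  s ^+ 2 * B u u + 2 * (s * t) * B u v + t ^+ 2 * B v v.
Proof. by rewrite BD !formDr !BZ !formZr (Bsym v u); ring. Qed.

Lemma form_CauchySchwarz u v : B u v ^+ 2 <= B u u * B v v.
Proof.
have [v0|v0] := eqVneq (B v v) 0.
  rewrite v0 mulr0 leNgt; apply/negP => h.
  have uv0 : B u v != 0 by apply/eqP => e; move: h; rewrite e expr0n ltxx.
  (* Here [B v v = 0], so the form is affine in the coefficient of [v]; this choice gives it the
     value -1. *)
  have := Bge0 (1%:C *: u + (- (B u u + 1) / (2 * B u v))%:C *: v).
  rewrite form_quad v0 mulr0 addr0 expr1n !mul1r.
  have -> : 2 * (- (B u u + 1) / (2 * B u v)) * B u v = - (B u u + 1) by field.
  by rewrite opprD addrA subrr sub0r oppr_ge0 leNgt ltr01.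
have vp : 0 < B v v by rewrite lt_neqAle eq_sym v0 Bge0.
have := Bge0 ((B v v)%:C *: u + (- B u v)%:C *: v).
rewrite form_quad.
have -> : B v v ^+ 2 * B u u + 2 * (B v v * - B u v) * B u v + (- B u v) ^+ 2 *
  B v v =
  B v v * (B u u * B v v - B u v ^+ 2) by ring.
by rewrite pmulr_rge0// subr_ge0.
Qed.

(** Each summand split off costs a factor 2, by the parallelogram inequality. Any constant depending
    on [n] alone would serve. *)
Lemma form_sum_le n (u : 'I_n -> V) :
  B (\sum_(i < n) u i) (\sum_(i < n) u i) <= 2 ^+ n * \sum_(i < n) B (u i) (u
    i).
Proof.
have B0 x : B 0 x = 0 by have := BZ 0 0 x; rewrite scaler0 mul0r.
elim: n u => [|n IH] u; first by rewrite !big_ord0 B0 mulr0.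
rewrite !big_ord_recl; set s := \sum_(i < n) _; set t := \sum_(i < n) _.
have h : B s s <= 2 ^+ n * t := IH (fun i => u (lift ord0 i)).
have t0 : 0 <= t by apply: sumr_ge0.
have := Bge0 (1%:C *: u ord0 + (-1)%:C *: s).
rewrite form_quad => hd.
have := form_quad 1 1 (u ord0) s; rewrite !scale1r => ->.
have n1 : (1 : R) <= 2 ^+ n by rewrite exprn_ege1// ler1n.
rewrite (exprS 2 n); have := Bge0 (u ord0); have := ler_wpM2r (Bge0 (u ord0))
  n1.
lra.
Qed.

Let N u := Num.sqrt (B u u).

Let N_triangle u v : N (u + v) <= N u + N v.
Proof.
rewrite -(ler_pXn2r (n := 2)) ?nnegrE ?addr_ge0 ?sqrtr_ge0//.
rewrite sqrrD !sqr_sqrtr// BD !formDr (Bsym v u).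
have : B u v <= N u * N v.
  rewrite (le_trans (ler_norm _))// -(ler_pXn2r (n := 2)) ?nnegrE ?mulr_ge0
    ?sqrtr_ge0//.
  by rewrite exprMn !sqr_sqrtr// real_normK ?num_real// form_CauchySchwarz.
rewrite /N; lra.
Qed.

Let NZ r u : N (r%:C *: u) = `|r| * N u.
Proof. by rewrite /N BZ formZr mulrA -expr2 sqrtrM ?sqr_ge0// sqrtr_sqr. Qed.

Section SymmetricOperator.
Variable M : V -> V.
Hypothesis Msym : forall u v, B (M u) v = B u (M v).

(** Symmetry rewrites the squared norm of [M^(k+1) u] as the product of [M^k u] with [M^(k+2) u];
    Cauchy-Schwarz then is log-convexity. *)
Lemma symmetric_growth u C T : 0 < T ->
  (forall k, B (iter k M u) (iter k M u) <= C * (k.+1)%:R ^+ 2 * T ^+ k) ->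
  B (M u) (M u) <= T * B u u.
Proof.
move=> T0 h; apply: (logconvex_growth (a := fun k => B (iter k M u) (iter k M
  u)) T0) => //.
move=> k /=; rewrite [in X in X ^+ 2]Msym; exact: form_CauchySchwarz.
Qed.

End SymmetricOperator.

Section PositiveOperator.
Variables (A : V -> V) (s : R).
Hypothesis s0 : 0 < s.
Hypothesis Asym : forall u v, B (A u) v = B u (A v).
Hypothesis Apos : forall u, 0 <= B (A u) u.
Hypothesis AD : forall u v, A (u + v) = A u + A v.
Hypothesis AZ : forall (r : R) u, A (r%:C *: u) = r%:C *: A u.
Hypothesis Agrowth : forall u, exists C, forall k,
  B (iter k A u) (iter k A u) <= C * (s ^+ 2) ^+ k.

(** The growth constant may depend on [u]; log-convexity removes it and leaves a uniform bound. *)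
Let A_bounded u : B (A u) (A u) <= s ^+ 2 * B u u.
Proof.
have [C hC] := Agrowth u.
apply: (symmetric_growth (C := `|C|) Asym); first exact: exprn_gt0.
move=> k; rewrite (le_trans (hC k))// ler_wpM2r ?exprn_ge0 ?(ltW s0)//.
rewrite (le_trans (ler_norm _))// ler_peMr// -natrX ler1n.
by rewrite expn_gt0.
Qed.

Lemma positive_form_le u : B (A u) u <= s * B u u.
Proof.
rewrite (le_trans (ler_norm _))// -(ler_pXn2r (n := 2)) ?nnegrE ?mulr_ge0 ?(ltW
  s0)//.
rewrite real_normK ?num_real// (le_trans (form_CauchySchwarz _ _))//.
rewrite exprMn (expr2 (B u u)) mulrA ler_wpM2r//; exact: A_bounded.
Qed.

(** This is [A^2 <= s A] without a square root of [A]: Cauchy-Schwarz for the form [B (A x) y] at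
    [u] and [A u], then [positive_form_le] at [A u], and division by [B (A u) (A u)]. *)
Let A_cs u : B (A u) (A u) <= s * B (A u) u.
Proof.
have [e|n] := eqVneq (B (A u) (A u)) 0; first by rewrite e mulr_ge0// ltW.
have p : 0 < B (A u) (A u) by rewrite lt_neqAle eq_sym n Bge0.
rewrite -(ler_pM2l p).
pose BA x y := B (A x) y.
have BAcs x y : BA x y ^+ 2 <= BA x x * BA y y.
  have Aneg z : A (- z) = - A z.
    have := AZ (-1) z; rewrite rmorphN1 !scaleN1r; exact.
  have BAq (t r : R) : BA (t%:C *: x + r%:C *: y) (t%:C *: x + r%:C *: y) =
      t ^+ 2 * BA x x + 2 * (t * r) * BA x y + r ^+ 2 * BA y y.
    rewrite /BA AD !AZ BD !formDr !BZ !formZr (Asym y x) (Bsym y (A x)); ring.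
  have [v0|v0] := eqVneq (BA y y) 0.
    rewrite v0 mulr0 leNgt; apply/negP => h.
    have uv0 : BA x y != 0 by apply/eqP => e; move: h; rewrite e expr0n ltxx.
    have := Apos (1%:C *: x + (- (BA x x + 1) / (2 * BA x y))%:C *: y).
    rewrite [X in 0 <= X]BAq v0 mulr0 addr0 expr1n !mul1r.
    have -> : 2 * (- (BA x x + 1) / (2 * BA x y)) * BA x y = - (BA x x + 1) by
      field.
    by rewrite opprD addrA subrr sub0r oppr_ge0 leNgt ltr01.
  have vp : 0 < BA y y by rewrite lt_neqAle eq_sym v0; exact: Apos.
  have := Apos ((BA y y)%:C *: x + (- BA x y)%:C *: y).
  rewrite [X in 0 <= X]BAq.
  have -> : BA y y ^+ 2 * BA x x + 2 * (BA y y * - BA x y) * BA x y + (- BA x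
    y) ^+ 2 * BA y y =
    BA y y * (BA x x * BA y y - BA x y ^+ 2) by ring.
  by rewrite pmulr_rge0// subr_ge0.
have := BAcs u (A u); rewrite /BA expr2 => h; apply: (le_trans h).
rewrite (le_trans (ler_wpM2l (Apos u) (positive_form_le (A u))))//.
by rewrite le_eqVlt; apply/orP; left; apply/eqP; ring.
Qed.

Lemma shifted_contraction u :
  B (s%:C *: u - A u) (s%:C *: u - A u) <= s ^+ 2 * B u u.
Proof.
have -> : s%:C *: u - A u = s%:C *: u + (-1)%:C *: A u by rewrite rmorphN1
  scaleN1r.
rewrite form_quad (Bsym u (A u)).
have := A_cs u; have := mulr_ge0 (ltW s0) (Apos u); lra.
Qed.

End PositiveOperator.

Section PositivityCriterion.
Variables (P : V -> V) (s : R).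
Hypothesis s0 : 0 < s.
Hypothesis Psym : forall u v, B (P u) v = B u (P v).
Hypothesis PD : forall u v, P (u + v) = P u + P v.
Hypothesis PZ : forall (r : R) u, P (r%:C *: u) = r%:C *: P u.

(** With [M = s - P], the identity [M^(k+1) u = s M^k u - M^k (P u)] carries the growth along [P u]
    over to [u]. Expanding the resulting bound on [M u] gives [B (P u) (P u) <= 2 s B (P u) u],
    whose left side is nonnegative. *)
Lemma growth_positive u C :
  (forall k, B (iter k (fun x => s%:C *: x - P x) (P u))
       (iter k (fun x => s%:C *: x - P x) (P u)) <= C * (s ^+ 2) ^+ k) ->
  0 <= B (P u) u.
Proof.
set M := fun x => _; move=> hC.
have PN x : P (- x) = - P x by have := PZ (-1) x; rewrite rmorphN1 !scaleN1r.
have MB x y : M (x - y) = M x - M y.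
  by rewrite /M PD PN scalerBr !opprD !opprK; rewrite addrACA.
have MZ x : M (s%:C *: x) = s%:C *: M x by rewrite /M PZ scalerBr.
have Miter k x : iter k M (s%:C *: x - P x) = s%:C *: iter k M x - iter k M (P
  x).
  by elim: k => // k IH; rewrite !iterS IH MB MZ.
have Msym x y : B (M x) y = B x (M y).
  have -> : M x = s%:C *: x + (-1)%:C *: P x by rewrite rmorphN1 scaleN1r.
  have -> : M y = s%:C *: y + (-1)%:C *: P y by rewrite rmorphN1 scaleN1r.
  by rewrite BD formDr !BZ !formZr Psym.
pose c := Num.sqrt `|C| / s.
have c0 : 0 <= c by rewrite divr_ge0 ?sqrtr_ge0 ?ltW.
have NP k : N (iter k M (P u)) <= c * s ^+ k.+1.
  rewrite -(ler_pXn2r (n := 2)) ?nnegrE ?sqrtr_ge0 ?(mulr_ge0 c0) ?exprn_ge0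
    ?(ltW s0)//.
  rewrite sqr_sqrtr// (le_trans (hC k))//.
  have -> : c * s ^+ k.+1 = Num.sqrt `|C| * s ^+ k.
    by rewrite exprS mulrA divfK// lt0r_neq0.
  rewrite [leRHS]exprMn sqr_sqrtr// -!exprM mulnC ler_wpM2r ?exprn_ge0 ?(ltW
    s0)//.
  exact: ler_norm.
(* Each step adds one term [c * s ^+ k.+1], whence the factor linear in [k]; its square is absorbed
   by [(k + 1)^2] in [symmetric_growth]. *)
have NM k : N (iter k M u) <= (N u + k%:R * c) * s ^+ k.
  elim: k => [|k IH]; first by rewrite mul0r addr0 mulr1.
  rewrite iterSr Miter -scaleN1r -(rmorphN1 (real_complex R)).
  rewrite (le_trans (N_triangle _ _))// !NZ normrN1 mul1r gtr0_norm//.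
  have := NP k; have := ler_wpM2l (ltW s0) IH; rewrite -natr1 !exprS; lra.
have hM := @symmetric_growth M Msym u ((N u + c) ^+ 2) (s ^+ 2) (exprn_gt0 2
  s0).
have {hM} : B (M u) (M u) <= s ^+ 2 * B u u.
  apply: hM => k; have N0 := sqrtr_ge0 (B u u).
  rewrite -(sqr_sqrtr (Bge0 (iter k M u))) -exprM mulnC exprM -!exprMn.
  rewrite ler_pXn2r ?nnegrE ?sqrtr_ge0 ?mulr_ge0 ?addr_ge0 ?exprn_ge0 ?(ltW
    s0)//.
  rewrite (le_trans (NM k))// ler_wpM2r ?exprn_ge0 ?(ltW s0)//.
  have k0 : (0 : R) <= k%:R by [].
  rewrite -/(N u) in N0; have := mulr_ge0 k0 N0.
  by rewrite -natr1; generalize (N u); move=> x; lra.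
have -> : M u = s%:C *: u + (-1)%:C *: P u by rewrite rmorphN1 scaleN1r.
rewrite form_quad (Bsym u (P u)) => h.
have := Bge0 (P u); rewrite -[X in _ -> is_true X](pmulr_rge0 _ s0); lra.
Qed.

End PositivityCriterion.
End SemiInner.

Lemma ReD (R : realType) (x y : R[i]) :
  complex.Re (x + y) = complex.Re x + complex.Re y.
Proof. by case: x y => ? ? []. Qed.

Lemma Re_sum (R : realType) (I : Type) (s : seq I) (P : pred I)
    (F : I -> R[i]) :
  complex.Re (\sum_(i <- s | P i) F i) = \sum_(i <- s | P i) complex.Re (F i).
Proof. by elim/big_rec2 : _ => // i x y _ <-; rewrite ReD. Qed.

Lemma Re_conj (R : realType) (x : R[i]) :
  complex.Re (Num.conj x) = complex.Re x.
Proof. by case: x. Qed.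

Lemma ReZ (R : realType) (r : R) (x : R[i]) :
  complex.Re (r%:C * x) = r * complex.Re x.
Proof. by case: x => a b /=; rewrite mul0r subr0. Qed.

(** * Real-valued norms and inner products *)

Section RealNorm.
Context (R : realType) (V : normedModType R[i]).
Implicit Types u v w : V.

Lemma norm_rnorm w : `|w| = (rnorm w)%:C.
Proof. by rewrite /rnorm RRe_real// normr_real. Qed.

Lemma rnorm_ge0 w : 0 <= rnorm w.
Proof. by rewrite -ler0c -norm_rnorm. Qed.

Lemma rnormD u v : rnorm (u + v) <= rnorm u + rnorm v.
Proof. by rewrite -lecR rmorphD /= -!norm_rnorm ler_normD. Qed.

Lemma rnormN u : rnorm (- u) = rnorm u.
Proof. by rewrite /rnorm normrN. Qed.

Lemma rnorm0 : rnorm (0 : V) = 0.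
Proof. by rewrite /rnorm normr0. Qed.

Lemma rnormZ (z : R[i]) u : rnorm (z *: u) = complex.Re `|z| * rnorm u.
Proof.
rewrite /rnorm normrZ norm_rnorm.
by rewrite -[ `|z| ]RRe_real ?normr_real// -rmorphM.
Qed.

Lemma rnormZr (r : R) u : rnorm (r%:C *: u) = `|r| * rnorm u.
Proof. by rewrite rnormZ normc_def /= expr0n addr0 sqrtr_sqr. Qed.

Lemma rnorm_sum (I : Type) (s : seq I) (P : pred I) (F : I -> V) :
  rnorm (\sum_(i <- s | P i) F i) <= \sum_(i <- s | P i) rnorm (F i).
Proof.
elim/big_rec2 : _ => [|i y x _ h]; first by rewrite rnorm0.
by rewrite (le_trans (rnormD _ _))// lerD2l.
Qed.

Lemma rnormB u v : rnorm (u - v) = rnorm (v - u).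
Proof. by rewrite -rnormN opprB. Qed.

End RealNorm.

Section HilbertSpace.
Context (R : realType) (X : hilbertSpace R).
Implicit Types u v w : X.
Local Notation dot := (hs_dot X).

Lemma hs_dotDl u v w : dot (u + v) w = dot u w + dot v w.
Proof. exact: linearDl. Qed.

Lemma hs_dotZl z u v : dot (z *: u) v = z * dot u v.
Proof. exact: linearZl_LR. Qed.

Lemma hs_dotC u v : dot u v = Num.conj (dot v u).
Proof. by rewrite hermC expr0 mul1r. Qed.

Lemma hs_dotZr z u v : dot u (z *: v) = Num.conj z * dot u v.
Proof.
by rewrite hs_dotC hs_dotZl rmorphM; congr (_ * _); exact/esym/hs_dotC.
Qed.

Lemma hs_dot0l u : dot 0 u = 0.
Proof. by rewrite -(scale0r 0) hs_dotZl mul0r. Qed.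

Lemma hs_dot_suml (I : Type) (s : seq I) (P : pred I) (F : I -> X) v :
  dot (\sum_(i <- s | P i) F i) v = \sum_(i <- s | P i) dot (F i) v.
Proof.
elim/big_rec2 : _ => [|i y x _ h]; first exact: hs_dot0l.
by rewrite hs_dotDl h.
Qed.

Definition Redot u v : R := complex.Re (dot u v).

Lemma Redot_sym u v : Redot u v = Redot v u.
Proof. by rewrite /Redot hs_dotC Re_conj. Qed.

Lemma RedotD u v w : Redot (u + v) w = Redot u w + Redot v w.
Proof. by rewrite /Redot hs_dotDl ReD. Qed.

Lemma RedotZ (r : R) u v : Redot (r%:C *: u) v = r * Redot u v.
Proof. by rewrite /Redot hs_dotZl ReZ. Qed.

Lemma hs_dot_rnorm v : dot v v = (rnorm v ^+ 2)%:C.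
Proof. by rewrite -hs_norm norm_rnorm -rmorphXn. Qed.

Lemma Redot_rnorm v : Redot v v = rnorm v ^+ 2.
Proof. by rewrite /Redot hs_dot_rnorm. Qed.

Lemma Redot_ge0 v : 0 <= Redot v v.
Proof. by rewrite Redot_rnorm sqr_ge0. Qed.

Lemma Redot_le u v : `|Redot u v| <= rnorm u * rnorm v.
Proof.
rewrite -(ler_pXn2r (n := 2)) ?nnegrE ?mulr_ge0 ?rnorm_ge0//.
rewrite real_normK ?num_real// exprMn -!Redot_rnorm.
exact: (form_CauchySchwarz Redot_sym RedotD RedotZ Redot_ge0).
Qed.

End HilbertSpace.

(** * Bundle operations and the representation on the bundle space *)

Section FellBundleAlgebra.
Context (R : realType) (G : topGroupType) (B : fellBundle R G).
Local Notation E := (bundle_space B).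

Definition bmul (p q : E) : E := bpt (fb_mul (bvec p) (bvec q)).
Definition bstar (p : E) : E := bpt (fb_star (bvec p)).

Lemma bptK (p : E) : bpt (bvec p) = p. Proof. by case: p. Qed.

Lemma bmulA p q r : bmul (bmul p q) r = bmul p (bmul q r).
Proof. exact: fb_mulA. Qed.

Lemma bstarK p : bstar (bstar p) = p.
Proof. by rewrite /bstar fb_starK bptK. Qed.

Lemma bstarM p q : bstar (bmul p q) = bmul (bstar q) (bstar p).
Proof. exact: fb_starM. Qed.

Lemma bpt_fiber_cast (x y : G) (e : x = y) (b : fiber B x) :
  bpt (fiber_cast e b) = bpt b.
Proof. by case: y / e. Qed.

Lemma fiber_castD (x y : G) (e : x = y) (a b : fiber B x) :
  fiber_cast e (a + b) = fiber_cast e a + fiber_cast e b.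
Proof. by case: y / e. Qed.

Lemma fiber_castZ (x y : G) (e : x = y) z (a : fiber B x) :
  fiber_cast e (z *: a) = z *: fiber_cast e a.
Proof. by case: y / e. Qed.

Lemma rnorm_fiber_cast (x y : G) (e : x = y) (a : fiber B x) :
  rnorm (fiber_cast e a) = rnorm a.
Proof. by case: y / e. Qed.

Lemma fb_mul_rnorm (x y : G) (a : fiber B x) (b : fiber B y) :
  rnorm (fb_mul a b) <= rnorm a * rnorm b.
Proof. by rewrite -lecR rmorphM /= -!norm_rnorm fb_mul_norm. Qed.

Lemma fb_cstar_rnorm (x : G) (a : fiber B x) :
  rnorm (fb_mul (fb_star a) a) = rnorm a ^+ 2.
Proof. by apply: complexI; rewrite rmorphXn /= -!norm_rnorm fb_cstar. Qed.

End FellBundleAlgebra.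

Section RepresentationOnBundle.
Context (R : realType) (G : topGroupType) (H : closedSubgroup G).
Context (B : fellBundle R G) (X : hilbertSpace R).
Variable S : starRep (restriction H B) X.
Local Notation E := (bundle_space B).
Local Notation dot := (hs_dot X).

Definition sub_elt (x : G) (hx : x \in csg_set H) : H := exist _ x hx.

(* The representation extended by zero from the restriction of the bundle to
   [H], so that elements over propositionally equal points need no casts. *)
Definition rep_at (p : E) : X -> X :=
  match pselect (bproj p \in csg_set H) with
  | left h => S (sub_elt h) (bvec p)
  | right _ => fun=> 0
  end.

Lemma rep_at_in (x : G) (b : fiber B x) (hx : x \in csg_set H) :
  rep_at (bpt b) = S (sub_elt hx) b.
Proof.
rewrite /rep_at; case: pselect => [h|//].
by rewrite (bool_irrelevance h hx).
Qed.

Lemma rep_at_sgval (h : H) (b : fiber (restriction H B) h) (v : X) :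
  rep_at (@bpt _ _ B (sgval h) b) v = S h b v.
Proof. by case: h b => x hx b; rewrite (rep_at_in _ hx). Qed.

End RepresentationOnBundle.

(** * Positivity of finite sums *)

Section RepAt.
Context (R : realType) (G : topGroupType) (H : closedSubgroup G).
Context (B : fellBundle R G) (X : hilbertSpace R).
Variable S : starRep (restriction H B) X.
Local Notation E := (bundle_space B).
Local Notation dot := (hs_dot X).
Local Notation rep := (rep_at S).

Lemma rep_atD (x : G) (a b : fiber B x) v :
  rep (bpt (a + b)) v = rep (bpt a) v + rep (bpt b) v.
Proof.
case: (pselect (x \in csg_set H)) => [hx|hx].
  by rewrite !(rep_at_in _ _ hx); exact: (@rep_fiberD _ _ _ _ S (sub_elt hx)).
by rewrite /rep_at; case: pselect => //= _; rewrite addr0.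
Qed.

Lemma rep_atZ (x : G) z (a : fiber B x) v :
  rep (bpt (z *: a)) v = z *: rep (bpt a) v.
Proof.
case: (pselect (x \in csg_set H)) => [hx|hx].
  by rewrite !(rep_at_in _ _ hx); exact: (@rep_fiberZ _ _ _ _ S (sub_elt hx)).
by rewrite /rep_at; case: pselect => //= _; rewrite scaler0.
Qed.

Lemma rep_at_linear (p : E) z u v : rep p (z *: u + v) = z *: rep p u + rep p v.
Proof.
rewrite /rep_at; case: pselect => h; last by rewrite scaler0 addr0.
exact: rep_linear.
Qed.

Lemma rep_at_vD (p : E) u v : rep p (u + v) = rep p u + rep p v.
Proof. by rewrite -[u]scale1r rep_at_linear !scale1r. Qed.

Lemma rep_at_v0 (p : E) : rep p 0 = 0.
Proof. by apply: (@addrI _ (rep p 0)); rewrite -rep_at_vD !addr0. Qed.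

Lemma rep_at_vZ (p : E) z u : rep p (z *: u) = z *: rep p u.
Proof. by rewrite -[z *: u]addr0 rep_at_linear rep_at_v0 addr0. Qed.

Lemma rep_at_mul (p q : E) v : bproj p \in csg_set H -> bproj q \in csg_set H ->
  rep (bmul p q) v = rep p (rep q v).
Proof.
case: p q => x a [y b] /= hx hy.
rewrite (rep_at_in _ a hx) (rep_at_in _ b hy).
rewrite (rep_at_in _ _ (group_closedM (csg_group H) hx hy)).
rewrite -(@rep_mul _ _ _ _ S (sub_elt hx) (sub_elt hy)).
by rewrite -rep_at_sgval -[in RHS]rep_at_sgval.
Qed.

Lemma rep_at_star (p : E) v w : bproj p \in csg_set H ->
  dot (rep (bstar p) v) w = dot v (rep p w).
Proof.
case: p => x a /= hx.
rewrite (rep_at_in _ a hx) -(@rep_star _ _ _ _ S (sub_elt hx)).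
by rewrite -[in RHS]rep_at_sgval.
Qed.

(** Strong continuity at the zero of one fibre, followed by scaling. The constant depends on [x] and
    [v], which is harmless in growth estimates and avoids proving that representations are
    contractive. *)
Lemma rep_at_bounded (x : G) v : x \in csg_set H ->
  exists2 C, 0 <= C & forall b : fiber B x, rnorm (rep (bpt b) v) <= C * rnorm
    b.
Proof.
move=> hx; pose h := sub_elt hx.
pose BH := restriction H B.
have c0 : (@bpt _ _ BH h @ nbhs (0 : fiber BH h)) --> @bpt _ _ BH h 0.
  apply: (bnorm_cvg0 (fb_banach BH)).
    apply/cvgrPdist_lt => e e0.
    have e0' : 0 < e%:C :> R[i] by rewrite ltcR.
    have := @nbhs0_lt _ (fiber BH h) _ e0'; apply: filterS => b /= be.
    rewrite sub0r normrN ger0_norm; last exact: rnorm_ge0.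
    by rewrite -ltcR -norm_rnorm.
  exact: cvg_cst.
have c1 : (fun b : fiber BH h => S h b v) @ nbhs (0 : fiber BH h) --> S h 0 v.
  exact: (cvg_comp _ _ c0 (@rep_strongly_continuous _ _ _ _ S v _)).
have S0 : S h 0 v = 0.
  by have := @rep_fiberZ _ _ _ _ S h 0 0 v; rewrite !scale0r.
rewrite S0 in c1.
have : \forall b \near (0 : fiber BH h), `|S h b v| < 1.
  exact: (@cvgr0_norm_lt R[i] X (fiber BH h) (nbhs (0 : fiber BH h)) _ (fun b
    => S h b v) c1 1 ltr01).
move=> /nbhs_norm0P [e /= e0 he].
have eE : e = (complex.Re e)%:C by rewrite RRe_real// gtr0_real.
have re0 : 0 < complex.Re e by rewrite -ltcR -eE.
exists (2 / complex.Re e); first by rewrite divr_ge0// ltW.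
move=> b; rewrite (rep_at_in _ _ hx) -/h.
have [b0|b0] := eqVneq (rnorm b) 0.
  have -> : b = 0.
    by apply/eqP; rewrite -normr_eq0 norm_rnorm b0.
  by rewrite S0 !rnorm0 mulr0.
have bp : 0 < rnorm b by rewrite lt_neqAle eq_sym b0 rnorm_ge0.
pose t := complex.Re e / (2 * rnorm b).
have t0 : 0 < t by rewrite divr_gt0// mulr_gt0.
have : rnorm (S h (t%:C *: b : fiber BH h) v) < 1.
  rewrite -ltcR -norm_rnorm; apply: he => /=.
  rewrite norm_rnorm eE ltcR rnormZr gtr0_norm//.
  have -> : t * rnorm b = complex.Re e / 2 by rewrite /t; field.
  by rewrite ltr_pdivrMr// mulr_natr mulr2n ltrDl.
rewrite (@rep_fiberZ _ _ _ _ S h) rnormZr gtr0_norm// => h1.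
have -> : 2 / complex.Re e * rnorm b = t^-1.
  by rewrite /t; field; rewrite b0 lt0r_neq0.
by rewrite -(ler_pM2l t0) divff ?lt0r_neq0// ltW.
Qed.

(** The operator-valued inner product [S(u^* v)], meaningful when [u] and [v] lie over the same left
    coset of [H], and 0 otherwise. *)
Definition pairing (x x' : G) (u : fiber B x) (v : fiber B x') : X -> X :=
  rep (bmul (bstar (bpt u)) (bpt v)).

Lemma pairingDl (x x' : G) (u u' : fiber B x) (v : fiber B x') w :
  pairing (u + u') v w = pairing u v w + pairing u' v w.
Proof.
by rewrite /pairing /bmul /bstar /bvec /= fb_starD fb_mulDl rep_atD.
Qed.

Lemma pairingDr (x x' : G) (u : fiber B x) (v v' : fiber B x') w :
  pairing u (v + v') w = pairing u v w + pairing u v' w.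
Proof. by rewrite /pairing /bmul /bstar /bvec /= fb_mulDr rep_atD. Qed.

Lemma pairingZr (x x' : G) z (u : fiber B x) (v : fiber B x') w :
  pairing u (z *: v) w = z *: pairing u v w.
Proof. by rewrite /pairing /bmul /bstar /bvec /= fb_mulZr rep_atZ. Qed.

Lemma pairingZl (x x' : G) z (u : fiber B x) (v : fiber B x') w :
  pairing (z *: u) v w = Num.conj z *: pairing u v w.
Proof. by rewrite /pairing /bmul /bstar /bvec /= fb_starZ fb_mulZl rep_atZ. Qed.

Lemma pairing0r (x x' : G) (u : fiber B x) w : pairing u (0 : fiber B x') w = 0.
Proof. by rewrite -(scale0r 0) pairingZr scale0r. Qed.

Lemma pairing_sumr (x x' : G) (u : fiber B x) (I : Type) (s : seq I)
    (F : I -> fiber B x') w :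
  pairing u (\sum_(i <- s) F i) w = \sum_(i <- s) pairing u (F i) w.
Proof.
elim: s => [|i s IH]; first by rewrite !big_nil pairing0r.
by rewrite !big_cons pairingDr IH.
Qed.

Lemma pairing_adj (x x' : G) (u : fiber B x) (v : fiber B x') w z :
  (x^-1 * x')%g \in csg_set H ->
  dot (pairing v u w) z = dot w (pairing u v z).
Proof.
by move=> h; rewrite -rep_at_star// bstarM bstarK.
Qed.

Lemma csg_group1 : 1%g \in csg_set H. Proof. exact: (csg_group H).1. Qed.

(** [S] need not act on [u], but it acts on the [c] over the identity with [u^* u = c^* c], and the
    form becomes the squared norm of [S_c w]. *)
Lemma pairing_ge0 (x : G) (u : fiber B x) w : 0 <= Redot (pairing u u w) w.
Proof.
have [c hc] := fb_positive u.
have -> : pairing u u = pairing c c.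
  by rewrite /pairing; congr rep_at.
have c1 : bproj (bpt c) \in csg_set H by exact: csg_group1.
have cV : bproj (bstar (bpt c)) \in csg_set H.
  exact: (group_closedV (csg_group H) csg_group1).
by rewrite /pairing /Redot rep_at_mul// rep_at_star//; exact: Redot_ge0.
Qed.

End RepAt.

(** * Positivity of the matrix of pairings over one coset *)

Section DiscretePositivity.
Context (R : realType) (G : topGroupType) (H : closedSubgroup G).
Context (B : fellBundle R G) (X : hilbertSpace R).
Variable S : starRep (restriction H B) X.
Local Notation dot := (hs_dot X).
Local Notation pr := (pairing S).
Variables (n : nat) (y : 'I_n -> G) (b : forall j, fiber B (y j)).
Hypothesis yH : forall i j, ((y i)^-1 * y j)%g \in csg_set H.

Let theta (j : 'I_n) (x : G) (d : fiber B x) : fiber B x :=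
  fiber_cast (mulVKg (y j) x) (fb_mul (b j) (fb_mul (fb_star (b j)) d)).

Let bpt_theta j (x : G) (d : fiber B x) :
  bpt (theta j d) = bmul (bpt (b j)) (bmul (bstar (bpt (b j))) (bpt d)).
Proof. exact: bpt_fiber_cast. Qed.

Let A (x : G) (d : fiber B x) : fiber B x := \sum_(j < n) theta j d.

Let AD (x : G) (u v : fiber B x) : A (u + v) = A u + A v.
Proof.
rewrite /A -big_split; apply: eq_bigr => j _.
by rewrite /theta !fb_mulDr fiber_castD.
Qed.

Let AZ (x : G) (z : R[i]) (u : fiber B x) : A (z *: u) = z *: A u.
Proof.
rewrite /A scaler_sumr; apply: eq_bigr => j _.
by rewrite /theta !fb_mulZr fiber_castZ.
Qed.

Section Fiber.
Variables (x : G) (w : X).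

Let form (u v : fiber B x) : R := Redot (pr u v w) w.

Let xH : (x^-1 * x)%g \in csg_set H.
Proof. by rewrite mulVg; exact: csg_group1. Qed.

Let form_sym u v : form u v = form v u.
Proof. by rewrite /form /Redot (pairing_adj S)//; exact: Redot_sym. Qed.

Let formD u v t : form (u + v) t = form u t + form v t.
Proof. by rewrite /form pairingDl RedotD. Qed.

Let formZ (r : R) u v : form (r%:C *: u) v = r * form u v.
Proof.
rewrite /form pairingZl -RedotZ; congr (Redot (_ *: _) _).
exact: conjc_real.
Qed.

Let form_ge0 u : 0 <= form u u.
Proof. exact: pairing_ge0. Qed.

Let pairing_A (u v : fiber B x) :
  pr u (A v) w = \sum_(j < n) pr u (theta j v) w.
Proof. exact: pairing_sumr. Qed.

Let A_sym (u v : fiber B x) : form (A u) v = form u (A v).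
Proof.
rewrite form_sym /form !pairing_A /Redot !hs_dot_suml !Re_sum.
apply: eq_bigr => j _; rewrite -!/(Redot _ _) -/(form _ _) -/(form _ _)
  form_sym.
rewrite /form /pairing !bpt_theta; congr (Redot (rep_at S _ _) _).
by rewrite !bstarM bstarK !bmulA.
Qed.

Let A_pos (u : fiber B x) : 0 <= form (A u) u.
Proof.
rewrite form_sym /form pairing_A /Redot hs_dot_suml Re_sum;
  apply: sumr_ge0 => j _.
have := pairing_ge0 S (fb_mul (fb_star (b j)) u) w;
  congr (_ <= Redot (rep_at S _ _) _).
rewrite bpt_theta.
rewrite (_ : bpt (fb_mul (fb_star (b j)) u) = bmul (bstar (bpt (b j))) (bpt
  u))//.
by rewrite bstarM bstarK bmulA.
Qed.

(** The [s] of the overview. It bounds [A] on every fibre at once, as it must to serve both for [P]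
    and for the fibres over all the [y j]; the [+ 1] makes it positive. *)
Definition theta_norm : R :=
  \sum_(j < n) rnorm (b j) * rnorm (fb_star (b j)) + 1.

Lemma theta_norm_gt0 : 0 < theta_norm.
Proof.
by rewrite ltr_wpDl// sumr_ge0// => j _; rewrite mulr_ge0// rnorm_ge0.
Qed.

Let A_norm (u : fiber B x) : rnorm (A u) <= theta_norm * rnorm u.
Proof.
rewrite (le_trans (rnorm_sum _ _ _))// mulrDl mul1r mulr_suml.
rewrite -[leLHS]addr0 lerD ?rnorm_ge0//; apply: ler_sum => j _.
rewrite rnorm_fiber_cast (le_trans (fb_mul_rnorm _ _))// -mulrA.
by rewrite ler_wpM2l ?rnorm_ge0// fb_mul_rnorm.
Qed.

(** By [rep_at_bounded] on the fibre containing [d^* d] and the C*-identity, [form d d] is at most a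
    constant times the squared norm of [d]; the fibre norms of the iterates are bounded by
    submultiplicativity. *)
Let A_growth (u : fiber B x) : exists C, forall k,
  form (iter k (@A x) u) (iter k (@A x) u) <= C * (theta_norm ^+ 2) ^+ k.
Proof.
have [C C0 hC] := rep_at_bounded S w xH.
exists (C * rnorm w * rnorm u ^+ 2) => k.
have nk : rnorm (iter k (@A x) u) <= theta_norm ^+ k * rnorm u.
  elim: k => [|k IH]; first by rewrite mul1r.
  rewrite iterS (le_trans (A_norm _))// exprS -mulrA ler_pM2l//.
  exact: theta_norm_gt0.
set d := iter k _ _ in nk *.
rewrite (le_trans (ler_norm _))// (le_trans (Redot_le _ _))//.
have := hC (fb_mul (fb_star d) d); rewrite fb_cstar_rnorm => h.
rewrite (le_trans (ler_wpM2r (rnorm_ge0 w) h))// mulrAC.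
rewrite -[leRHS]mulrA ler_wpM2l ?mulr_ge0 ?rnorm_ge0//.
rewrite -exprM mulnC exprM -exprMn mulrC; apply: lerXn2r => //.
- by rewrite nnegrE rnorm_ge0.
- by rewrite nnegrE mulr_ge0 ?exprn_ge0 ?rnorm_ge0// ltW// theta_norm_gt0.
Qed.

Hypothesis yx : forall i, ((y i)^-1 * x)%g \in csg_set H.

Let xy i : (x^-1 * y i)%g \in csg_set H.
Proof. by have := group_closedV (csg_group H) (yx i); rewrite invgM invgK. Qed.

Let pairing_comp i (x' : G) (u : fiber B x') (d : fiber B x) :
  (x'^-1 * y i)%g \in csg_set H ->
  pr u (b i) (pr (b i) d w) = pr u (theta i d) w.
Proof.
move=> h; rewrite /pairing -rep_at_mul//; last exact: yx.
by rewrite bpt_theta !bmulA.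
Qed.

(** Taking adjoints turns each squared norm into the form of [S(d^* b_i b_i^* d)]. This links norms
    in [X^n] with the action of [A] on a fibre. *)
Let sum_sqr (d : fiber B x) :
  \sum_(i < n) Redot (pr (b i) d w) (pr (b i) d w) = form (A d) d.
Proof.
rewrite A_sym form_sym form_sym /form pairing_A /Redot hs_dot_suml Re_sum.
apply: eq_bigr => i _; rewrite -!/(Redot _ _) -pairing_comp//.
by rewrite [RHS]Redot_sym /Redot pairing_adj.
Qed.

Let M (d : fiber B x) := theta_norm%:C *: d - A d.

Lemma theta_iter_bound (d : fiber B x) k :
  \sum_(i < n) Redot (pr (b i) (iter k M d) w) (pr (b i) (iter k M d) w) <=
  theta_norm * Redot (pr d d w) w * (theta_norm ^+ 2) ^+ k.
Proof.
have AZr (r : R) u : A (r%:C *: u) = r%:C *: A (u : fiber B x) by exact: AZ.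
rewrite sum_sqr.
rewrite (le_trans (positive_form_le form_sym formD formZ form_ge0 theta_norm_gt0
  A_sym A_growth _))// -mulrA ler_pM2l ?theta_norm_gt0// mulrC.
elim: k => [|k IH]; first by rewrite mul1r.
rewrite iterS exprS -mulrA.
rewrite (le_trans (shifted_contraction form_sym formD formZ form_ge0
  theta_norm_gt0
  A_sym A_pos (@AD x) AZr A_growth _))//.
by rewrite ler_pM2l// exprn_gt0// theta_norm_gt0.
Qed.

End Fiber.

Variable xi : 'I_n -> X.

Local Notation V := {ffun 'I_n -> X}.

Let formV (u v : V) : R := \sum_(i < n) Redot (u i) (v i).

Let formV_sym u v : formV u v = formV v u.
Proof. by apply: eq_bigr => i _; exact: Redot_sym. Qed.

Let formVD u v t : formV (u + v) t = formV u t + formV v t.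
Proof. by rewrite -big_split; apply: eq_bigr => i _; rewrite ffunE RedotD. Qed.

Let formVZ (r : R) u v : formV (r%:C *: u) v = r * formV u v.
Proof. by rewrite mulr_sumr; apply: eq_bigr => i _; rewrite ffunE RedotZ. Qed.

Let formV_ge0 u : 0 <= formV u u.
Proof. by apply: sumr_ge0 => i _; exact: Redot_ge0. Qed.

Let P (u : V) : V := [ffun i => \sum_(j < n) pr (b i) (b j) (u j)].

Let PD u v : P (u + v) = P u + P v.
Proof.
apply/ffunP => i; rewrite !ffunE -big_split; apply: eq_bigr => j _.
by rewrite ffunE [pairing _ _ _ _]rep_at_vD.
Qed.

Let PZ (r : R) u : P (r%:C *: u) = r%:C *: P u.
Proof.
apply/ffunP => i; rewrite !ffunE scaler_sumr; apply: eq_bigr => j _.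
by rewrite ffunE [pairing _ _ _ _]rep_at_vZ.
Qed.

Let dotP (u v : V) :
  \sum_(i < n) dot (P u i) (v i) = \sum_(i < n) dot (u i) (P v i).
Proof.
under eq_bigr do rewrite ffunE hs_dot_suml.
rewrite exchange_big; apply: eq_bigr => j _.
rewrite ffunE [RHS]hs_dotC hs_dot_suml rmorph_sum; apply: eq_bigr => i _.
by rewrite pairing_adj //; exact: hs_dotC.
Qed.

Let Psym u v : formV (P u) v = formV u (P v).
Proof. by rewrite /formV -!Re_sum dotP. Qed.

Let Md (x : G) (d : fiber B x) : fiber B x := theta_norm%:C *: d - A d.

Let Phi (d : forall j, fiber B (y j)) : V :=
  [ffun i => \sum_(j < n) pr (b i) (d j) (xi j)].

(** Since [S(b_i^* b_j) S(b_j^* d) = S(b_i^* b_j b_j^* d)], summing over [j] moves [P] into the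
    fibres as [A]. *)
Let P_Phi d : P (Phi d) = Phi (fun j => A (d j)).
Proof.
apply/ffunP => i; rewrite !ffunE.
transitivity (\sum_(j < n) \sum_(k < n) pr (b i) (b j) (pr (b j) (d k) (xi k))).
  apply: eq_bigr => j _; rewrite ffunE.
  elim/big_rec2 : _ => [|k v u _ IH]; first exact: rep_at_v0.
  by rewrite [LHS]rep_at_vD -IH.
rewrite exchange_big; apply: eq_bigr => k _.
rewrite /A pairing_sumr; apply: eq_bigr => j _.
rewrite /pairing -rep_at_mul //; [|exact: yH|exact: yH].
by rewrite bpt_theta !bmulA.
Qed.

Let M_Phi d :
  theta_norm%:C *: Phi d - P (Phi d) = Phi (fun j => Md (d j)).
Proof.
rewrite P_Phi; apply/ffunP => i; rewrite !ffunE scaler_sumr -sumrB.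
apply: eq_bigr => j _.
by rewrite /Md pairingDr pairingZr -(scaleN1r (A (d j))) pairingZr scaleN1r.
Qed.

Let M_iter k : iter k (fun u => theta_norm%:C *: u - P u) (P (finfun xi)) =
  Phi (fun j => iter k (@Md (y j)) (b j)).
Proof.
elim: k => [|k IH]; last by rewrite iterS IH M_Phi.
by apply/ffunP => i; rewrite !ffunE; apply: eq_bigr => j _; rewrite ffunE.
Qed.

Lemma pairing_posdef :
  0 <= \sum_(i < n) \sum_(j < n) dot (pr (b i) (b j) (xi j)) (xi i).
Proof.
have sumE : \sum_(i < n) \sum_(j < n) dot (pr (b i) (b j) (xi j)) (xi i) =
    \sum_(i < n) dot (P (finfun xi) i) (finfun xi i).
  apply: eq_bigr => i _; rewrite !ffunE hs_dot_suml.
  by apply: eq_bigr => j _; rewrite ffunE.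
(* In [R[i]] the order also asserts that the sum is real; this follows from symmetry of [P]. *)
rewrite sumE lecE /= Re_sum; apply/andP; split.
  set z := \sum_(i < n) _.
  have : Num.conj z = z.
    rewrite /z rmorph_sum [RHS]dotP; apply: eq_bigr => i _; exact/esym/hs_dotC.
  by case: z => r m [] /= /eqP; rewrite eq_sym -addr_eq0 -mulr2n mulrn_eq0.
have hP := @growth_positive R V formV formV_sym formVD formVZ formV_ge0 P
  theta_norm
  theta_norm_gt0 Psym PD PZ (finfun xi).
(* Independent of [k]: [2 ^+ n] comes from splitting [Phi] into the vectors [psi j], each of which
   involves a single fibre. *)
pose c := 2 ^+ n * \sum_(j < n) (theta_norm * Redot (pr (b j) (b j) (xi j)) (xi
  j)).
apply: (hP c) => k; rewrite M_iter.
pose psi (j : 'I_n) : V := [ffun i => pr (b i) (iter k (@Md (y j)) (b j)) (xi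
  j)].
have -> : Phi (fun j => iter k (@Md (y j)) (b j)) = \sum_(j < n) psi j.
  apply/ffunP => i; rewrite ffunE sum_ffunE; apply: eq_bigr => j _.
  by rewrite ffunE.
rewrite (le_trans (form_sum_le formV_sym formVD formVZ formV_ge0 _))//.
rewrite /c -mulrA ler_wpM2l ?exprn_ge0// mulr_suml; apply: ler_sum => j _.
rewrite /formV; under eq_bigr do rewrite ffunE.
by apply: theta_iter_bound => i; exact: yH.
Qed.

End DiscretePositivity.

(** * Bochner integrals *)

Section FiniteAdditivity.
Context d (T : measurableType d) (R : realType) (mu : {measure set T -> \bar
  R}).

Lemma fine_measure_partition n (A : 'I_n -> set T) (U : set T) :
  (forall i, measurable (A i)) -> trivIset setT A -> measurable U ->
  (mu U < +oo)%E -> U `<=` \bigcup_i A i ->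
  fine (mu U) = \sum_(i < n) fine (mu (U `&` A i)).
Proof.
move=> mA tA mU Uoo UA.
have -> : U = \big[setU/set0]_(i < n) (U `&` A i).
  rewrite -(bigcup_seq (index_enum 'I_n)); apply/seteqP;
    split=> [x Ux|x [i _ []]//].
  by have [i _ Ax] := UA x Ux; exists i => //=; rewrite mem_index_enum.
rewrite measure_bigsetU_ord//=; first last.
- exact: trivIset_setIl.
- by move=> i; exact: measurableI.
have fin i : mu (U `&` A i) \is a fin_num.
  rewrite ge0_fin_numE//; apply: le_lt_trans Uoo.
  by apply: le_measure; rewrite ?inE//; exact: measurableI.
rewrite -EFin_sum_fine//=; apply: eq_bigr => i _; congr (fine (mu _)).
rewrite -(bigcup_seq (index_enum 'I_n)); apply/seteqP; split=> x.
  by move=> [Ux Ax]; split => //; exists i => //=; rewrite mem_index_enum.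
by move=> [[j _ [Ux _]] Ax].
Qed.

End FiniteAdditivity.

(** * Real functionals and Bochner integrals *)

Section BochnerFunctional.
Context d (T : measurableType d) (R : realType) (V : completeNormedModType
  R[i]).
Variable mu : {measure set T -> \bar R}.
Variables (lam : V -> R) (C : R).
Hypothesis lamD : forall u v, lam (u + v) = lam u + lam v.
Hypothesis lamZ : forall (r : R) u, lam (r%:C *: u) = r * lam u.
Hypothesis C0 : 0 <= C.
Hypothesis lamC : forall u, `|lam u| <= C * rnorm u.

Let lam0 : lam 0 = 0.
Proof. by have := lamZ 0 0; rewrite scaler0 mul0r. Qed.

Let lam_sum (I : Type) (s : seq I) (F : I -> V) :
  lam (\sum_(i <- s) F i) = \sum_(i <- s) lam (F i).
Proof. by elim: s => [|i s IH]; rewrite ?big_nil// !big_cons lamD IH. Qed.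

Let lamB u v : lam (u - v) = lam u - lam v.
Proof.
have := lamZ (-1) v; rewrite rmorphN1 scaleN1r mulN1r => h.
by rewrite lamD h.
Qed.

Let indC (A : set T) x : (\1_A x : R[i]) = (\1_A x : R)%:C.
Proof. by rewrite !indicE; case: (_ \in _). Qed.

Let lam_simple s x :
  lam (simple_fun s x) = \sum_(p <- s) lam p.2 * \1_(p.1 : set T) x.
Proof.
rewrite /simple_fun lam_sum; apply: eq_bigr => p _.
by rewrite indC lamZ mulrC.
Qed.

Let integrable_ind (A : set T) (c : R) : measurable A -> (mu A < +oo)%E ->
  mu.-integrable [set: T] (fun x => (c * \1_A x)%:E).
Proof.
move=> mA Aoo.
have : mu.-integrable [set: T] (fun x => (\1_A x)%:E : \bar R).
  apply/integrableP; split; first by apply/measurable_EFinP;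
    exact: measurable_indic.
  under eq_integral => x _ do rewrite gee0_abs ?lee_fin//.
  by rewrite integral_indic// setIT.
by move=> /(integrableZl measurableT c).
Qed.

Let lam_simple_integral (s : seq (set T * V)) : simple_integrable mu s ->
  mu.-integrable [set: T] (EFin \o (fun x => lam (simple_fun s x))) /\
  \int[mu]_x lam (simple_fun s x) = lam (simple_integral mu s).
Proof.
elim: s => [_|p s IH hs].
  have -> : (fun x : T => lam (simple_fun [::] x)) = (fun=> 0).
    by apply/funext => x; rewrite lam_simple big_nil.
  split; first exact: integrable0.
  by rewrite /simple_integral big_nil lam0 Rintegral_cst// mul0r.
have [|i1 e1] := IH; first by move=> q qs; apply: hs; rewrite inE qs orbT.
have [mp fp] := hs p (mem_head _ _).
have i2 := integrable_ind (lam p.2) mp fp.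
have -> : (fun x : T => lam (simple_fun (p :: s) x)) =
    (fun x => lam p.2 * \1_(p.1 : set T) x + lam (simple_fun s x)).
  by apply/funext => x; rewrite !lam_simple big_cons.
split; first by have := integrableD measurableT i2 i1.
rewrite RintegralD// e1 /simple_integral big_cons lamD lamZ; congr (_ + _).
have [l0|l0] := eqVneq (lam p.2) 0.
  rewrite l0 mulr0; under eq_Rintegral do rewrite mul0r.
  by rewrite Rintegral_cst// mul0r.
rewrite RintegralZl//; last first.
  by have := integrable_ind 1 mp fp; under eq_fun do rewrite mul1r.
by rewrite /Rintegral integral_indic// setIT mulrC.
Qed.

(** On simple functions this is additivity. Both sides are then within [C * eta] of the value on an
    approximating simple function. *)
Lemma bochner_integral_functional (F : T -> V) (v : V) :
  is_bochner_integral mu F v ->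
  mu.-integrable [set: T] (EFin \o (lam \o F)) ->
  lam v = \int[mu]_x lam (F x).
Proof.
move=> [s [hs ms cs cI]] iF.
apply/eqP; rewrite -subr_eq0 -normr_eq0 eq_le normr_ge0 andbT.
apply/ler_addgt0Pr => e e0; rewrite add0r.
have C1 : 0 < C + 1 by rewrite ltr_wpDl.
pose eta := e / 2 / (C + 1).
have eta0 : 0 < eta by rewrite !divr_gt0.
have n1 : \forall n \near \oo, rnorm (v - simple_integral mu (s n)) < eta.
  have etaC : 0 < eta%:C :> R[i] by rewrite ltcR.
  have /cvgrPdist_lt /(_ _ etaC) := cI; apply: filterS => n /=.
  by rewrite norm_rnorm ltcR.
have n2 : \forall n \near \oo,
    (\int[mu]_x (rnorm (F x - simple_fun (s n) x))%:E < eta%:E)%E.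
  have h : nbhs (0%E : \bar R) [set x | (x < eta%:E)%E].
    by apply: open_ereal_lt'; rewrite lte_fin.
  exact: cs _ h.
near \oo => n.
have h1 : rnorm (v - simple_integral mu (s n)) < eta by near: n.
have h2 : (\int[mu]_x (rnorm (F x - simple_fun (s n) x))%:E < eta%:E)%E by
  near: n.
have [is_ es] := lam_simple_integral (hs n).
rewrite -(subrK (lam (simple_integral mu (s n))) (lam v)) -addrA -lamB.
rewrite (le_trans (ler_normD _ _))// [leRHS]splitr lerD//.
  rewrite (le_trans (lamC _))// (le_trans (ler_wpM2l C0 (ltW h1)))//.
  rewrite /eta mulrA ler_pdivrMr// mulrC ler_wpM2l ?lerDl// divr_ge0// ltW//.
rewrite distrC -es -RintegralB//.
rewrite (le_trans (le_normr_Rintegral _ _))//; first by have := integrableB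
  measurableT iF is_.
have mr : measurable_fun [set: T] (fun x => rnorm (F x - simple_fun (s n) x))
  := ms n.
have ir : mu.-integrable [set: T]
    (EFin \o (fun x => rnorm (F x - simple_fun (s n) x))).
  apply/integrableP; split; first exact/measurable_EFinP.
  under eq_integral => x _ do rewrite gee0_abs ?lee_fin ?rnorm_ge0//.
  by rewrite (lt_trans h2)// ltry.
apply: (@le_trans _ _ (\int[mu]_x (C * rnorm (F x - simple_fun (s n) x)))).
  apply: le_Rintegral => //.
  - apply: integrable_norm; exact: (integrableB measurableT iF is_).
  - exact: (integrableZl measurableT C ir).
  - by move=> x _; rewrite -lamB.
rewrite RintegralZl//.
have h3 : \int[mu]_x rnorm (F x - simple_fun (s n) x) <= eta.
  rewrite -lee_fin /Rintegral fineK ?ltW//.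
  exact: (integrable_fin_num measurableT ir).
rewrite (le_trans (ler_wpM2l C0 h3))//.
by rewrite /eta mulrA ler_pdivrMr// mulrC ler_wpM2l ?lerDl// divr_ge0// ltW//.
Unshelve. all: by end_near. Qed.

End BochnerFunctional.

(** * Existence of Bochner integrals *)

Section BochnerExistence.
Context (R : realType) (T : ptopologicalType) (V : completeNormedModType R[i]).
Variable mu : {measure set (borel T) -> \bar R}.
Hypothesis hausT : hausdorff_space T.
Hypothesis mu_compact : forall K : set T, compact K -> (mu K < +oo)%E.
Variables (F : T -> V) (K : set T).
Hypothesis cF : forall c : V, continuous (fun x => rnorm (F x - c)).
Hypothesis cK : compact K.
Hypothesis FK : forall x, F x != 0 -> K x.

Let partition (e : R) : 0 < e -> exists n (A : 'I_n -> set T) (c : 'I_n -> T),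
  [/\ forall i, measurable (A i : set (borel T)),
      forall i x, A i x -> rnorm (F x - F (c i)) < e,
      forall i, K (c i), trivIset setT A & \bigcup_i A i = K].
Proof.
move=> e0.
have nb x : K x -> nbhs x [set y | rnorm (F y - F x) < e].
  move=> _; have := @cF (F x) x; rewrite /continuous_at subrr rnorm0 => h.
  exact: (cvgr_lt 0 h e e0).
have [n [A [c [mA AU Kc tA AK]]]] := compact_partition hausT cK nb.
by exists n, A, c; split => // i x /AU.
Qed.

(** Partitions of [K] on whose pieces [F] stays within [1 / (k + 1)] of a value give simple
    functions with Cauchy integrals. Continuity is required only of the norms of [F x - c], which is
    what continuity into a bundle space provides directly. *)
Lemma bochner_integral_exists :
  exists v, is_bochner_integral (T := borel T) mu F v.
Proof.
pose e k : R := k.+1%:R^-1.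
have e0 k : 0 < e k by rewrite invr_gt0.
pose Q k (w : {n : nat & (('I_n -> set T) * ('I_n -> T))%type}) :=
  let A := (projT2 w).1 in let c := (projT2 w).2 in
  [/\ forall i, measurable (A i : set (borel T)),
      forall i x, A i x -> rnorm (F x - F (c i)) < e k,
      forall i, K (c i), trivIset setT A & \bigcup_i A i = K].
have /choice[w hw] : forall k, exists w, Q k w.
  by move=> k; have [n [A [c h]]] := partition (e0 k);
    exists (existT _ n (A, c)).
pose A k := (projT2 (w k)).1; pose c k := (projT2 (w k)).2.
pose s k : seq (set (borel T) * V) := [seq (A k i, F (c k i)) | i <- index_enum
  'I_(projT1 (w k))].
pose M := fine (mu K).
have M0 : 0 <= M by rewrite fine_ge0.
have mK := compact_measurable_borel hausT cK.
have AK k i : A k i `<=` K by have [_ _ _ _ <-] := hw k; exact: bigcup_sup.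
have mA k i : measurable (A k i : set (borel T)) by have [h _ _ _ _] := hw k;
  exact: h.
have tA k : trivIset setT (A k) by have [_ _ _ h _] := hw k.
have UA k : \bigcup_i A k i = K by have [_ _ _ _ h] := hw k.
have eA k i x : A k i x -> rnorm (F x - F (c k i)) < e k.
  by have [_ h _ _ _] := hw k; exact: h.
have Aoo k i : (mu (A k i) < +oo)%E.
  apply: le_lt_trans (mu_compact cK); apply: le_measure; rewrite ?inE//;
    exact: AK.
have sE k i x : A k i x -> simple_fun (s k) x = F (c k i).
  move=> Ax; rewrite /simple_fun big_map (bigD1 i)//= indicE mem_set// scale1r.
  rewrite big1 ?addr0// => j ji; rewrite indicE memNset ?scale0r// => Ajx.
  have /trivIsetP/(_ j i I I ji) ji0 := tA k.
  by suff : (A k j `&` A k i) x by rewrite ji0.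
have s0 k x : ~ K x -> simple_fun (s k) x = 0.
  move=> nK; rewrite /simple_fun big_map big1// => i _.
  by rewrite indicE memNset ?scale0r// => /AK.
have F0 x : ~ K x -> F x = 0.
  by move=> nK; apply: contrapT => /eqP /FK.
pose r k (x : borel T) := rnorm (F x - simple_fun (s k) x).
have rK k x : r k x != 0 -> K x.
  move=> h; apply: contrapT => nK; move/eqP: h; apply.
  by rewrite /r s0// F0// subr0 rnorm0.
have re k x : `|r k x| <= e k.
  rewrite ger0_norm ?rnorm_ge0//; have [Kx|nK] := pselect (K x).
    by move: (Kx); rewrite -(UA k) => -[i _ Ax]; rewrite /r (sE k i)// ltW// eA.
  by rewrite /r s0// F0// subr0 rnorm0 ltW.
have mr k : measurable_fun [set: borel T] (r k).
  have -> : r k = fun x => \sum_(i < projT1 (w k)) \1_(A k i) x * rnorm (F x -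
    F (c k i)).
    apply/funext => x; have [Kx|nK] := pselect (K x).
      move: (Kx); rewrite -(UA k) => -[i _ Ax]; rewrite /r (sE k i)//.
      rewrite (bigD1 i)//= indicE mem_set// mul1r big1 ?addr0// => j ji.
      rewrite indicE memNset ?mul0r// => Ajx.
      have /trivIsetP/(_ j i I I ji) ji0 := tA k.
      by suff : (A k j `&` A k i) x by rewrite ji0.
    rewrite /r s0// F0// subr0 rnorm0 big1// => i _.
    by rewrite indicE memNset ?mul0r// => /AK.
  apply: measurable_sum => i; apply: measurable_funM => //.
  exact: continuous_measurable_borel.
(* Both integrals are expanded over the common refinement, whose cells have measures [m i j]. A
   nonempty cell has a point close to both values of [F]; an empty cell has measure 0. *)
have dist k l : rnorm (simple_integral mu (s k) - simple_integral mu (s l)) <=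
    (e k + e l) * M.
  pose m i j := fine (mu (A k i `&` A l j)).
  have mI i j : measurable (A k i `&` A l j : set (borel T)) by exact:
    measurableI.
  have mE i : fine (mu (A k i)) = \sum_j m i j.
    by apply: fine_measure_partition => //; rewrite UA; exact: AK.
  have mE' j : fine (mu (A l j)) = \sum_i m i j.
    rewrite (fine_measure_partition (mA k) (tA k))//; last by rewrite UA;
      exact: AK.
    by apply: eq_bigr => i _; rewrite setIC.
  have mM : M = \sum_i \sum_j m i j.
    rewrite /M (fine_measure_partition (mA k) (tA k) mK (mu_compact cK)) ?UA//.
    apply: eq_bigr => i _; rewrite -mE; congr (fine (mu _)).
    by apply/setIidr; exact: AK.
  have -> : simple_integral mu (s k) - simple_integral mu (s l) =
      \sum_i \sum_j (m i j)%:C *: (F (c k i) - F (c l j)).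
    have -> : simple_integral mu (s k) = \sum_i \sum_j (m i j)%:C *: F (c k i).
      rewrite /simple_integral big_map; apply: eq_bigr => i _ /=.
      by rewrite mE rmorph_sum scaler_suml.
    have -> : simple_integral mu (s l) = \sum_i \sum_j (m i j)%:C *: F (c l j).
      rewrite exchange_big /simple_integral big_map; apply: eq_bigr => j _ /=.
      by rewrite mE' rmorph_sum scaler_suml.
    rewrite -sumrB; apply: eq_bigr => i _; rewrite -sumrB;
      apply: eq_bigr => j _.
    by rewrite scalerBr.
  rewrite (le_trans (rnorm_sum _ _ _))// mM mulr_sumr; apply: ler_sum => i _.
  rewrite (le_trans (rnorm_sum _ _ _))// mulr_sumr; apply: ler_sum => j _.
  rewrite rnormZr ger0_norm ?fine_ge0// mulrC.
  have [AA0|/set0P[x [Ax Ax']]] := eqVneq (A k i `&` A l j) set0.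
    by rewrite /m AA0 measure0 !mulr0.
  rewrite ler_wpM2r ?fine_ge0//.
  rewrite -(subrK (F x) (F (c k i))) -addrA (le_trans (rnormD _ _))//.
  by rewrite lerD// ltW// ?eA// rnormB eA.
have eC : e @ \oo --> (0 : R) by exact: cvg_harmonic.
have eM d : 0 < d -> \forall k \near \oo, e k * M < d.
  move=> d0; have : (fun k => e k * M) @ \oo --> 0 * M.
    by apply: cvgMl; exact: eC.
  by rewrite mul0r => h; exact: (cvgr_lt 0 h d d0).
have : cauchy (simple_integral mu (s k) @[k --> \oo]).
  apply: cauchy_exP => d d0.
  have dE : d = (complex.Re d)%:C by rewrite RRe_real// gtr0_real.
  have rd0 : 0 < complex.Re d by rewrite -ltcR -dE.
  have [N _ hN] := eM _ (divr_gt0 rd0 (ltr0n R 2)).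
  exists (simple_integral mu (s N)); exists N => // k /= Nk.
  rewrite -ball_normE /= norm_rnorm dE ltcR (le_lt_trans (dist _ _))//.
  by rewrite [ltRHS]splitr mulrDl ltrD// hN//=.
move=> /cauchy_cvg /cvg_ex[/= v hv].
exists v, s; split => //.
- by move=> k p /mapP[i _ ->] /=.
- have int k : (\int[mu]_x (r k x)%:E = (\int[mu]_x r k x)%:E)%E.
    rewrite /Rintegral fineK//; apply: integrable_fin_num => //.
    exact: (bounded_integrable hausT mu_compact cK (mr k) (rK k) (re k)).
  rewrite (_ : (fun k => _) = EFin \o (fun k => \int[mu]_x r k x)); last first.
    by apply/funext => k; exact: int.
  apply: cvg_EFin; first by near=> k.
  apply/cvgrPdist_lt => d d0; near=> k.
  rewrite sub0r normrN (le_lt_trans (normr_Rintegral_le hausT mu_compact cK (mr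
    k) (rK k) (re k)))//.
  by near: k; exact: eM.
Unshelve. all: by end_near. Qed.

End BochnerExistence.

(** * Positivity of the integrated form *)

Section NormContinuity.
Context (R : realType).

(** The topology of the fibre is not compared with that of the bundle space: [g t - c] is a bundle
    sum with a constant point, to which the bundle norm is applied. *)
Lemma bundle_rnorm_continuous (Y : topologicalType) (B : topBundle R Y)
    (hB : is_banach_bundle B) (T : topologicalType) (x : Y) (g : T -> fiber B
      x) :
  continuous (fun t => bpt (g t) : bundle_space B) ->
  forall c, continuous (fun t => rnorm (g t - c)).
Proof.
move=> cg c.
pose j (t : T) : bpairs B := existT _ x (g t, - c).
have cj : continuous (j : T -> initial_topology (@bpairs_incl _ _ B)).
  apply: continuous_initial.
  exact: cont_pair cg (@cst_continuous T (bundle_space B) (bpt (- c))).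
move=> t.
apply: (@continuous_comp _ _ _ (fun t => badd (j t)) (@bnorm _ _ B)).
  apply: (@continuous_comp _ _ _ (j : T -> initial_topology (@bpairs_incl _ _
    B))
    (@badd _ _ B)); [exact: cj|exact: (badd_continuous hB)].
exact: bnorm_continuous.
Qed.

(** The bundle axioms give continuity of scaling by a fixed scalar. The variable factor
    [(Delta y)^-1] of [f^*] is therefore handled by a norm estimate. *)
Lemma scaled_rnorm_continuous (T : topologicalType) (V : normedModType R[i])
    (r : T -> R) (g : T -> V) : continuous r ->
  (forall c, continuous (fun t => rnorm (g t - c))) ->
  forall c, continuous (fun t => rnorm ((r t)%:C *: g t - c)).
Proof.
move=> cr cg c t0; apply/cvgrPdist_lt => e e0.
pose k t := `|r t| * rnorm (g t - g t0) + `|r t - r t0| * rnorm (g t0).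
have ck : k t @[t --> t0] --> (0 : R).
  have -> : 0 = `|r t0| * rnorm (g t0 - g t0) + `|r t0 - r t0| * rnorm (g t0).
    by rewrite !subrr rnorm0 normr0 mulr0 mul0r addr0.
  apply: cvgD; apply: cvgM.
  - by apply: cvg_norm; exact: cr.
  - exact: cg.
  - by apply: cvg_norm; exact: cvgB (cr t0) (@cst_continuous T R (r t0) t0).
  - exact: (@cst_continuous T R (rnorm (g t0)) t0).
have kle : \forall t \near t0, k t < e by exact: cvgr_lt 0 ck e e0.
near=> t; apply: (@le_lt_trans _ _ (k t)); last by near: t.
have rev (u v : V) : `|rnorm u - rnorm v| <= rnorm (u - v).
  have := rnormD (u - v) v; have := rnormD (v - u) u;
    rewrite !subrK (rnormB v u).
  by rewrite ler_norml => h1 h2; apply/andP; split; lra.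
rewrite (le_trans (rev _ _))// opprB addrA subrK rnormB.
have -> : (r t)%:C *: g t - (r t0)%:C *: g t0 =
    (r t)%:C *: (g t - g t0) + (r t - r t0)%:C *: g t0.
  by rewrite rmorphB scalerBr scalerBl addrA subrK.
by rewrite (le_trans (rnormD _ _))// !rnormZr.
Unshelve. all: by end_near. Qed.

End NormContinuity.

(** * The integrated form tested against a vector *)

Section Assembly.
Context (R : realType) (G : topGroupType).
Hypothesis hausG : hausdorff_space G.
Hypothesis lcG : locally_compact [set: G].
Variable H : closedSubgroup G.
Variables (mu : {measure set (borel G) -> \bar R}) (Delta : G -> R).
Variables (nu : {measure set (borel H) -> \bar R}) (delta : H -> R).
Hypotheses (haar_mu : left_haar mu) (modDelta : is_modular mu Delta).
Hypotheses (haar_nu : left_haar nu) (moddelta : is_modular nu delta).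
Variables (B : fellBundle R G) (X : hilbertSpace R).
Variable S : starRep (restriction H B) X.
Variable f : forall x, fiber B x.
Hypothesis ccf : cc_section f.
Variable v : X.
Variable z : R[i].
Hypothesis z0 : 0 <= complex.Re z.
Local Notation dot := (hs_dot X).

(** A real functional suits the scalar integration results; the factor [z] gives access to the
    imaginary part as well. *)
Let lam (u : X) : R := complex.Re (z * dot u v).

Let lamE u : lam u = Redot (z *: u) v.
Proof. by rewrite /lam /Redot hs_dotZl. Qed.

Let lamD u u' : lam (u + u') = lam u + lam u'.
Proof. by rewrite !lamE scalerDr RedotD. Qed.

Let lamZ (r : R) u : lam (r%:C *: u) = r * lam u.
Proof. by rewrite !lamE scalerA mulrC -scalerA RedotZ. Qed.

Let C := complex.Re `|z| * rnorm v.

Let C0 : 0 <= C.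
Proof. by rewrite mulr_ge0 ?rnorm_ge0// normc_def /= sqrtr_ge0. Qed.

Let lamC u : `|lam u| <= C * rnorm u.
Proof.
by rewrite lamE (le_trans (Redot_le _ _))// rnormZ /C mulrAC.
Qed.

Let lam_continuous : continuous lam.
Proof.
move=> u; apply/cvgrPdist_lt => e e0.
have C1 : 0 < C + 1 by rewrite ltr_wpDl.
have e1 : 0 < (e / (C + 1))%:C :> R[i] by rewrite ltcR divr_gt0.
have near_u : \forall u' \near u, `|u - u'| < (e / (C + 1))%:C.
  by have /cvgrPdist_lt /(_ _ e1) : (fun u' : X => u') @ nbhs u --> u by exact:
    cvg_id.
near=> u'; have : `|u - u'| < (e / (C + 1))%:C by near: u'.
rewrite norm_rnorm ltcR => h.
have lamN w : lam (- w) = - lam w by have := lamZ (-1) w;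
  rewrite rmorphN1 scaleN1r mulN1r.
rewrite -lamN -lamD (le_lt_trans (lamC _))// (le_lt_trans (ler_wpM2l C0 (ltW
  h)))//.
by rewrite mulrA ltr_pdivrMr// mulrC ltr_pM2l// ltrDl.
Unshelve. all: by end_near. Qed.

Let sec := section_map f.

Let kappa (p : G * H) : R :=
  lam (rep_at S (bmul (bstar (sec p.1)) (sec (p.1 * sgval p.2)%g)) v).

Let csec : continuous sec := ccf.1.

Let cbmul (T : topologicalType) (p q : T -> bundle_space B) :
  continuous p -> continuous q -> continuous (fun t => bmul (p t) (q t)).
Proof. by move=> hp hq; exact: cont_comp (@fb_mul_continuous _ _ B) (cont_pair
  hp hq). Qed.

Let cbstar (T : topologicalType) (p : T -> bundle_space B) :
  continuous p -> continuous (fun t => bstar (p t)).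
Proof. by move=> hp; exact: cont_comp (@fb_star_continuous _ _ B) hp. Qed.

(** The argument of [S] in [kappa] as a point of the restricted bundle, the bundle for which strong
    continuity of [S] is available. *)
Let g (p : G * H) : bundle_space (restriction H B) :=
  @bpt _ _ (restriction H B) p.2
    (fiber_cast (mulKg p.1 (sgval p.2))
       (fb_mul (fb_star (f p.1)) (f (p.1 * sgval p.2)%g))).

Let csg : continuous (@sgval G H) := @sgval_continuous G H.

Let cg : continuous g.
Proof.
apply: continuous_restr.
have -> : (@restr_incl _ _ _ _ \o g : G * H -> bundle_space B) =
    (fun p => bmul (bstar (sec p.1)) (sec (p.1 * sgval p.2)%g)).
  by apply/funext => p; exact: bpt_fiber_cast.
apply: cbmul; first exact: cbstar (cont_comp csec (@cont_fst _ _)).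
apply: (cont_comp csec (k := fun p : G * H => (p.1 * sgval p.2)%g)).
exact: continuous_mulg (@cont_fst _ _) (cont_comp csg (@cont_snd _ _)).
Qed.

Let ckappa : continuous kappa.
Proof.
have -> : kappa = (fun p => lam ((fun b : bundle_space (restriction H B) => S _
  (bvec b) v) (g p))).
  apply/funext => p; rewrite /kappa -rep_at_sgval /=;
    congr (lam (rep_at S _ v)).
  by rewrite bpt_fiber_cast.
apply: (cont_comp lam_continuous).
exact: cont_comp (@rep_strongly_continuous _ _ _ _ S v) cg.
Qed.

Let lam0 : lam 0 = 0. Proof. by rewrite /lam hs_dot0l mulr0. Qed.

Let kappa_neq0 y h : kappa (y, h) != 0 -> f y != 0 /\ f (y * sgval h)%g != 0.
Proof.
move=> k0; split; apply/eqP => e; move/eqP: k0; apply;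
  rewrite /kappa /sec /section_map /= e.
  have := pairingZl S 0 (0 : fiber B y) (f (y * sgval h)%g) v;
    rewrite scale0r rmorph0 scale0r.
  by rewrite /pairing => ->.
by have := pairing0r S (y * sgval h)%g (f y) v; rewrite /pairing => ->.
Qed.

(** An instance of [pairing_posdef] with [b_i = f(y l_i)] and [xi_i = c_i v]. The sum there is real
    and nonnegative, so multiplication by [z] leaves its real part nonnegative. *)
Let kappa_posdef (y : G) n (l : 'I_n -> H) (c : 'I_n -> R) :
  0 <= \sum_(i < n) \sum_(j < n)
    c i * c j * kappa ((y * sgval (l i))%g, ((l i)^-1 * l j)%g).
Proof.
pose b (i : 'I_n) := f (y * sgval (l i))%g.
have yH i j : ((y * sgval (l i))^-1 * (y * sgval (l j)))%g \in csg_set H.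
  rewrite invgM -mulgA mulKg.
  exact: (sgvalP ((l i)^-1 * l j)%g).
have := pairing_posdef S (y := fun i => (y * sgval (l i))%g) b yH (fun i => (c
  i)%:C *: v).
set w := (X in 0 <= X) => w0.
suff -> : \sum_(i < n) \sum_(j < n)
    c i * c j * kappa ((y * sgval (l i))%g, ((l i)^-1 * l j)%g) = complex.Re (z
      * w).
  move: w0; rewrite lecE => /andP[/eqP im re]; move: im re z0.
  by case: (w) => a d; case: (z) => a' d' /= -> ha ha';
    rewrite mulr0 subr0 mulr_ge0.
rewrite /w mulr_sumr Re_sum; apply: eq_bigr => i _.
rewrite mulr_sumr Re_sum; apply: eq_bigr => j _.
rewrite [pairing _ _ _ _]rep_at_vZ hs_dotZl hs_dotZr.
rewrite (_ : Num.conj (c i)%:C = (c i)%:C); last exact: conjc_real.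
rewrite (mulrCA z) ReZ (mulrCA z) ReZ mulrA (mulrC (c i)).
congr (_ * complex.Re (_ * dot (rep_at S (bmul _ _) _) _)).
rewrite /sec /section_map /= (_ : sgval ((l i)^-1 * l j)%g = ((sgval (l i))^-1
  * sgval (l j))%g)//.
by rewrite -mulgA mulVKg.
Qed.
Let D0 x : 0 < Delta x := modular_gt0 modDelta x.
Let cD : continuous Delta := modular_continuous hausG lcG haar_mu modDelta.

Let xgetP' (T : choiceType) (A : set T) (x0 a : T) : A a -> A (xget x0 A).
Proof. by move=> Aa; apply: (xgetPex x0); exists a. Qed.

Let conv_integrand (h : G) (y : borel G) : fiber B h :=
  fiber_cast (mulVKg (y : G) h)
    (fb_mul (section_star Delta f y) (f ((y : G)^-1 * h)%g)).

Let conv_base (h : G) (y : G) : fiber B h :=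
  fiber_cast (mulVKg y h)
    (fb_mul (fiber_cast (invgK y) (fb_star (f y^-1%g))) (f (y^-1 * h)%g)).

Let conv_integrandE h (y : G) :
  conv_integrand h y = ((Delta y)^-1)%:C *: conv_base h y.
Proof.
by rewrite /conv_integrand /conv_base /section_star fb_mulZl fiber_castZ.
Qed.

Let bpt_conv_base h y :
  bpt (conv_base h y) = bmul (bstar (sec y^-1%g)) (sec (y^-1 * h)%g).
Proof.
rewrite bpt_fiber_cast.
rewrite (_ : bpt (fb_mul _ _) = bmul (bpt (fiber_cast (invgK y) (fb_star (f
  y^-1%g)))) (sec (y^-1 * h)%g))//.
by rewrite bpt_fiber_cast.
Qed.

(** As [section_conv] falls back on a default value, existence has to be proved before its value can
    be used. *)
Let conv_exists h : is_bochner_integral mu (conv_integrand h)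
  (section_conv mu (section_star Delta f) f h).
Proof.
have [K cK fK] := ccf.2.
have [b hb] : exists b, is_bochner_integral (T := borel G) mu (conv_integrand
  h) b.
  apply: (bochner_integral_exists hausG (haar_compact haar_mu) (K := [set x | K
    x^-1%g])).
  - move=> c.
    rewrite (_ : (fun y : G => _) = (fun y : G => rnorm ((Delta y)^-1%:C *:
      conv_base h y - c))); last first.
      by apply/funext => y; rewrite conv_integrandE.
    apply: scaled_rnorm_continuous.
      by move=> y; apply: cvgV; [exact: lt0r_neq0|exact: cD].
    apply: (bundle_rnorm_continuous (fb_banach B)).
    rewrite (_ : (fun y => _) = (fun y : G => bmul (bstar (sec y^-1%g)) (sec
      (y^-1 * h)%g))); last first.
      by apply/funext => y; exact: bpt_conv_base.
    apply: cbmul.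
      exact: cbstar (cont_comp csec (@invg_continuous G)).
    apply: (cont_comp csec (k := fun y : G => (y^-1 * h)%g)).
    exact: cont_comp (@continuous_mulgr G h) (@invg_continuous G).
  - exact: compact_invg.
  - move=> y; apply: contraPP => nK; apply/negP; rewrite negbK conv_integrandE.
    suff -> : conv_base h y = 0 by rewrite scaler0.
    have e : f y^-1%g = 0 by apply: contrapT => /eqP /fK.
    apply/eqP; rewrite -normr_eq0 norm_rnorm rnorm_fiber_cast -[X in _ ==
      X](rmorph0 (real_complex R)).
    rewrite (inj_eq (@complexI R)) eq_le rnorm_ge0 andbT (le_trans
      (fb_mul_rnorm _ _))//.
    rewrite rnorm_fiber_cast e.
    have -> : fb_star (0 : fiber B y^-1%g) = 0.
      by have := fb_starZ 0 (0 : fiber B y^-1%g); rewrite !scale0r rmorph0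
        scale0r.
    by rewrite rnorm0 mul0r.
exact: xgetP' hb.
Qed.

(** On the fibre over [h], [lam] composed with [S] is a bounded real functional and passes through
    the convolution. Inverting [y] then absorbs the factor [(Delta y)^-1] of [f^*]. *)
Let conv_kappa (h : H) :
  lam (rep_at S (bpt (section_conv mu (section_star Delta f) f (sgval h))) v) =
  \int[mu]_y kappa (y, h).
Proof.
have [K cK fK] := ccf.2; have muK := haar_compact haar_mu.
pose lamh (b : fiber B (sgval h)) := lam (rep_at S (bpt b) v).
have [C' C'0 hC'] := rep_at_bounded S v (sgvalP h).
have E (y : G) : lamh (conv_integrand (sgval h) y) = kappa (y^-1%g, h) * (Delta
  y)^-1.
  by rewrite conv_integrandE /lamh rep_atZ lamZ bpt_conv_base mulrC.
have sk y : kappa (y, h) != 0 -> K y by move=> /kappa_neq0[/fK].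
have ckh : continuous (fun y => kappa (y, h)) := continuous_fixr ckappa.
have cinv : continuous (fun y => kappa (y^-1%g, h) * (Delta y)^-1).
  have ci : continuous (fun y : G => kappa (y^-1%g, h)) := cont_comp ckh
    (@invg_continuous G).
  move=> y; apply: cvgM; first exact: ci.
  by apply: cvgV; [exact: lt0r_neq0|exact: cD].
have lhE : lamh \o conv_integrand (sgval h) = (fun y => kappa (y^-1%g, h) *
  (Delta y)^-1).
  by apply/funext => y; exact: E.
have -> : lam (rep_at S (bpt (section_conv mu (section_star Delta f) f (sgval
  h))) v) =
    \int[mu]_y lamh (conv_integrand (sgval h) y).
  have lamhD a b : lamh (a + b) = lamh a + lamh b by rewrite /lamh rep_atD lamD.
  have lamhZ (r : R) a : lamh (r%:C *: a) = r * lamh a by rewrite /lamh rep_atZ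
    lamZ.
  have lamhC a : `|lamh a| <= C * C' * rnorm a.
    by rewrite (le_trans (lamC _))// -[leRHS]mulrA ler_wpM2l.
  have := bochner_integral_functional lamhD lamhZ (mulr_ge0 C0 C'0) lamhC
    (conv_exists (sgval h)).
  apply; rewrite lhE; apply: (cc_integrable hausG muK cinv (compact_invg cK))
    => y.
  by rewrite mulf_eq0 negb_or => /andP[/sk].
under eq_Rintegral do rewrite E.
exact: (Rintegral_invg hausG lcG haar_mu modDelta ckh cK sk).
Qed.

Let w := restr_weight Delta delta.

Lemma rep_integral_functional_ge0 :
  0 <= complex.Re (z * dot (rep_integral nu S
    (restr_section Delta delta (section_conv mu (section_star Delta f) f)) v)
      v).
Proof.
have [K cK fK] := ccf.2.
set phi := restr_section _ _ _.
set u := rep_integral _ _ _ _.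
have sk y h : kappa (y, h) != 0 -> K y /\ K (y * sgval h)%g.
  by move=> /kappa_neq0[/fK ? /fK].
(* If the outer integral does not exist, its default value 0 satisfies the claim; otherwise [u] is a
   genuine integral and [lam] passes through it. *)
have [[b hb]|nb] := pselect (exists b, is_bochner_integral (T := borel H) nu
  (fun h : borel H => S h (phi h) v) b); last first.
  have -> : u = 0.
    by rewrite /u /rep_integral /bochner_integral xgetPN// => b hb; apply: nb;
      exists b.
  by rewrite hs_dot0l mulr0.
have hu : is_bochner_integral (T := borel H) nu (fun h : borel H => S h (phi h)
  v) u.
  exact: xgetP' hb.
have E (h : H) : lam (S h (phi h) v) = w h * \int[mu]_y kappa (y, h).
  rewrite /phi /restr_section (@rep_fiberZ _ _ _ _ S h) lamZ -conv_kappa.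
  by rewrite rep_at_sgval.
have lE : lam \o (fun h : borel H => S h (phi h) v) = (fun h => w h *
  \int[mu]_y kappa (y, h)).
  by apply/funext => h; exact: E.
rewrite -/(lam u) (bochner_integral_functional lamD lamZ C0 lamC hu);
  last first.
  rewrite lE.
  exact: (subgroup_integrand_integrable hausG lcG haar_mu modDelta haar_nu
    moddelta ckappa cK sk).
under eq_Rintegral do rewrite E.
exact: (Rintegral_subgroup_ge0 hausG lcG haar_mu modDelta haar_nu moddelta
  ckappa cK sk kappa_posdef).
Qed.

End Assembly.

Theorem theorem3p6 (R : realType) (G : topGroupType)
  (hausG : hausdorff_space G) (lcG : locally_compact [set: G])
  (H : closedSubgroup G)
  (mu : {measure set (borel G) -> \bar R}) (haar_mu : left_haar mu)
  (Delta : G -> R) (modDelta : is_modular mu Delta)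
  (nu : {measure set (borel H) -> \bar R}) (haar_nu : left_haar nu)
  (delta : H -> R) (moddelta : is_modular nu delta)
  (B : fellBundle R G) (X : hilbertSpace R)
  (S : starRep (restriction H B) X) :
  nondegenerate_rep S -> bundle_positive mu nu Delta delta S.
Proof.
move=> _ f ccf v.
(* [z = 1], [i] and [-i] give a nonnegative real part and no imaginary part. *)
have pos c := rep_integral_functional_ge0 hausG lcG haar_mu modDelta
  haar_nu moddelta S ccf v (z := c).
have := pos 1; have := pos 'i; have := pos (- 'i).
set t := hs_dot X _ _; case: t => a b /=.
rewrite !(mul0r, mul1r, oppr0, sub0r, mulN1r, opprK, subr0) => p1 p2 p3.
rewrite lecE /= p3// andbT eq_le -oppr_ge0 p1// p2//.
Qed.
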